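(* Let $\mathcal S \subseteq 2^\omega$ be a Scott set and let $A \in \mathcal S$. Then either there is $X \in \mathcal S$ that is weakly 2-random relative to $A$, or there is $X \in \mathcal S$ that is 1-generic relative to $A$.
   Context: A Scott set is a nonempty set $\mathcal S \subseteq 2^\omega$ closed under Turing reducibility (if $Y \le_T X \in \mathcal S$ then $Y \in \mathcal S$) and under joins $X \oplus Y$, and such that every infinite binary tree computable from an element of $\mathcal S$ has an infinite path in $\mathcal S$. A set $X$ is weakly 2-random relative to $A$ if $X$ does not belong to any $\Pi^0_2(A)$ class of Lebesgue measure $0$. A set $X$ is 1-generic relative to $A$ if for every set $W$ of finite binary strings that is c.e. in $A$, either some initial segment of $X$ lies in $W$, or some initial segment of $X$ has no extension in $W$. *)

(* Defs.v *)
From Stdlib Require Import Reals List Arith.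
Import ListNotations.
Open Scope R_scope.

Definition cset := nat -> bool.

Inductive code : Type :=
| CZero : code
| CSucc : code
| CProj : nat -> code
| COracle : code
| CComp : code -> list code -> code
| CPrec : code -> code -> code
| CMu : code -> code.

Inductive eval (X : cset) : code -> list nat -> nat -> Prop :=
| ev_zero args : eval X CZero args 0
| ev_succ args : eval X CSucc args (S (hd 0%nat args))
| ev_proj i args : eval X (CProj i) args (nth i args 0%nat)
| ev_oracle args : eval X COracle args (if X (hd 0%nat args) then 1%nat else 0%nat)
| ev_comp f gs args ys y :
    evals X gs args ys -> eval X f ys y -> eval X (CComp f gs) args y
| ev_prec0 f g args y :
    eval X f args y -> eval X (CPrec f g) (0%nat :: args) y
| ev_precS f g n args r y :
    eval X (CPrec f g) (n :: args) r -> eval X g (n :: r :: args) y ->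
    eval X (CPrec f g) (S n :: args) y
| ev_mu f args n :
    eval X f (n :: args) 0%nat ->
    (forall m, (m < n)%nat -> exists v, v <> 0%nat /\ eval X f (m :: args) v) ->
    eval X (CMu f) args n
with evals (X : cset) : list code -> list nat -> list nat -> Prop :=
| evs_nil args : evals X nil args nil
| evs_cons g gs args y ys :
    eval X g args y -> evals X gs args ys -> evals X (g :: gs) args (y :: ys).

Definition turing_le (Y X : cset) : Prop :=
  exists c, forall n, eval X c [n] (if Y n then 1%nat else 0%nat).

Definition join (X Y : cset) : cset :=
  fun n => if Nat.even n then X (Nat.div2 n) else Y (Nat.div2 n).

(* A string is a list bool, head = bit 0. Bijective coding into nat. *)
Fixpoint str_code (s : list bool) : nat :=
  match s with
  | nil => 0
  | false :: t => S (2 * str_code t)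
  | true :: t => S (S (2 * str_code t))
  end.

Definition prefix (s t : list bool) : Prop := exists u, t = s ++ u.

Definition init_seg (s : list bool) (X : cset) : Prop :=
  forall i, (i < length s)%nat -> nth i s false = X i.

Definition is_tree (T : list bool -> Prop) : Prop :=
  forall s t, prefix s t -> T t -> T s.

Definition infinite_tree (T : list bool -> Prop) : Prop :=
  forall l : list (list bool), exists s, T s /\ ~ In s l.

Definition tree_computable_from (T : list bool -> Prop) (Z : cset) : Prop :=
  exists c, forall s,
    (T s -> eval Z c [str_code s] 1%nat) /\ (~ T s -> eval Z c [str_code s] 0%nat).

Definition is_path (X : cset) (T : list bool -> Prop) : Prop :=
  forall s, init_seg s X -> T s.

Definition scott_set (S : cset -> Prop) : Prop :=
  (exists X, S X) /\
  (forall X Y, S X -> turing_le Y X -> S Y) /\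
  (forall X Y, S X -> S Y -> S (join X Y)) /\
  (forall T Z, S Z -> is_tree T -> infinite_tree T -> tree_computable_from T Z ->
     exists X, S X /\ is_path X T).

Definition ce_in_str (A : cset) (W : list bool -> Prop) : Prop :=
  exists c, forall s, W s <-> exists y, eval A c [str_code s] y.

(* Pi^0_2(A) class: P = intersection over n of the open sets generated
   (uniformly in n) by an A-c.e. set of strings. *)
Definition pi02_class (A : cset) (P : cset -> Prop) : Prop :=
  exists c, forall X, P X <->
    forall n, exists s, init_seg s X /\ exists y, eval A c [n; str_code s] y.

Fixpoint psum (f : nat -> R) (N : nat) : R :=
  match N with
  | O => 0
  | S k => psum f k + f k
  end.

Definition cyl_measure (s : list bool) : R := (/ 2) ^ length s.

Definition null_class (P : cset -> Prop) : Prop :=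
  forall eps : R, 0 < eps ->
    exists f : nat -> list bool,
      (forall X, P X -> exists i, init_seg (f i) X) /\
      (forall N, psum (fun i => cyl_measure (f i)) N <= eps).

Definition weakly_2_random_rel (A X : cset) : Prop :=
  forall P, pi02_class A P -> null_class P -> ~ P X.

Definition one_generic_rel (A X : cset) : Prop :=
  forall W, ce_in_str A W ->
    (exists s, init_seg s X /\ W s) \/
    (exists s, init_seg s X /\ forall t, prefix s t -> ~ W t).

(* Main.v *)
Require Import Defs.
From Stdlib Require Import Reals Lra Lia List Arith ClassicalEpsilon.
Import ListNotations.
Local Open Scope nat_scope.

(** Each index [e] of a Pi^0_2(A) class, an intersection of open sets [U_n], runs its
    own finite-injury construction of a limit [Y_e]. A requirement that wants to change
    the current approximation from position [x] on at stage [s] may do so only while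
    the part of [U_0 /\ ... /\ U_x] enumerated by stage [s] has small measure; that
    part is then declared bad. The priority order bounds the total measure of the bad
    sequences, over all [e], by 1/2, so an A-computable infinite tree avoids them and
    the Scott set contains a path [X] of it. If [X] is not weakly 2-random, it lies in a
    null class, say the [e]-th. Once [X] is seen in [U_0 /\ ... /\ U_y], bit [y] of the
    approximation never changes again, as a change would make [X] bad; hence [Y_e] is
    computable from [A] and [X]. Since the class is null, the measures tend to 0, so
    every requirement is eventually allowed to act, and [Y_e] is 1-generic. *)

(** * Oracle computability of typed functions *)

(** All indices [e] run at once because the class that contains [X] is known only after [X] is, and
    [X] is a path of a tree built from the constructions; a universal machine makes that tree
    computable from [A]. The obstacle is that a null Pi^0_2 class comes with no computable rate at
    which the measures fall, so no position can be computed in advance where the open set stays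
    small forever. Therefore the test concerns only what has been enumerated by stage [s], and only
    sequences already seen there are declared bad. This suffices: a sequence that enters later has
    not yet relied on the bits being changed, since it reads bit [y] only once it is seen in the
    first [y + 1] open sets. The allowance 2^-(e + 2i + 3) for an action of requirement [i] comes
    from counting actions: a requirement is injured only by those of smaller index, so it acts at
    most 2^i times, and a price of 4^-i per action leaves a convergent sum over [i]; the factor
    2^-(e + 3) then keeps the sum over [e] within 1/2. *)

Definition npair (a b : nat) : nat := (a + b) * (a + b) + a.
Definition nfst (n : nat) : nat := n - Nat.sqrt n * Nat.sqrt n.
Definition nsnd (n : nat) : nat := Nat.sqrt n - nfst n.

(** As [a] is at most [2 * (a + b)], the code stays below the next square, so decoding needs only
    square roots, products and truncated subtraction. *)
Lemma sqrt_npair a b : Nat.sqrt (npair a b) = a + b.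
Proof. apply Nat.sqrt_unique; unfold npair; nia. Qed.

Lemma nfst_npair a b : nfst (npair a b) = a.
Proof. unfold nfst; rewrite sqrt_npair; unfold npair; lia. Qed.

Lemma nsnd_npair a b : nsnd (npair a b) = b.
Proof. unfold nsnd; rewrite nfst_npair, sqrt_npair; lia. Qed.

Lemma npair_ge_snd a b : b <= npair a b.
Proof. unfold npair; nia. Qed.

Fixpoint prec {U : Type} (a : U) (g : nat -> U -> U) (n : nat) : U :=
  match n with 0 => a | S k => g k (prec a g k) end.

Section Rec.
Variable Z : cset.

Lemma eval_comp1 f g l a b :
  eval Z g l a -> eval Z f [a] b -> eval Z (CComp f [g]) l b.
Proof. intros; econstructor; [repeat econstructor|]; eassumption. Qed.

Lemma eval_comp2 f g h l a b c :
  eval Z g l a -> eval Z h l b -> eval Z f [a; b] c ->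
  eval Z (CComp f [g; h]) l c.
Proof. intros; econstructor; [repeat econstructor|]; eassumption. Qed.

Lemma eval_proj i l y : nth i l 0 = y -> eval Z (CProj i) l y.
Proof. intros <-; constructor. Qed.

Lemma eval_prec f g G l a :
  eval Z f l a -> (forall k r, eval Z g (k :: r :: l) (G k r)) ->
  forall n, eval Z (CPrec f g) (n :: l) (prec a G n).
Proof. intros Hf Hg; induction n; simpl; econstructor; eauto. Qed.

Fixpoint cconst (k : nat) : code :=
  match k with 0 => CZero | S k => CComp CSucc [cconst k] end.

Lemma eval_cconst k l : eval Z (cconst k) l k.
Proof.
  revert l; induction k; intros l; simpl; [constructor|].
  eapply eval_comp1; [apply IHk|apply (ev_succ Z [k])].
Qed.

Lemma eval_succ_of g l a : eval Z g l a -> eval Z (CComp CSucc [g]) l (S a).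
Proof. intros; eapply eval_comp1; [eassumption|apply (ev_succ Z [a])]. Qed.

Definition cadd := CPrec (CProj 0) (CComp CSucc [CProj 1]).
Definition cpred := CPrec CZero (CProj 0).
(* [csub] takes its arguments in reverse order, as recursion is on the first one. *)
Definition csub := CPrec (CProj 0) (CComp cpred [CProj 1]).
Definition cmul := CPrec CZero (CComp cadd [CProj 1; CProj 2]).

Lemma eval_cadd a b : eval Z cadd [a; b] (a + b).
Proof.
  replace (a + b) with (prec b (fun _ r => S r) a) by (induction a; simpl; lia).
  apply eval_prec; [apply eval_proj; reflexivity|].
  intros; apply eval_succ_of, eval_proj; reflexivity.
Qed.

Lemma eval_cpred a : eval Z cpred [a] (pred a).
Proof.
  replace (pred a) with (prec 0 (fun k _ => k) a) by (destruct a; reflexivity).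
  apply eval_prec; [constructor|intros; apply eval_proj; reflexivity].
Qed.

Lemma eval_csub a b : eval Z csub [b; a] (a - b).
Proof.
  replace (a - b) with (prec a (fun _ r => pred r) b) by (induction b; simpl; lia).
  apply eval_prec; [apply eval_proj; reflexivity|].
  intros; eapply eval_comp1; [apply eval_proj; reflexivity|apply eval_cpred].
Qed.

Lemma eval_cmul a b : eval Z cmul [a; b] (a * b).
Proof.
  replace (a * b) with (prec 0 (fun _ r => r + b) a) by (induction a; simpl; lia).
  apply eval_prec; [constructor|].
  intros; eapply eval_comp2; try (apply eval_proj; reflexivity); apply eval_cadd.
Qed.

Definition cbin f g h := CComp f [g; h].

(* The successive approximations [r] of the square root grow by one exactly
   when [(r + 1)^2 <= k + 1], which truncated subtraction tests. *)
Definition csqrt :=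
  CPrec CZero
    (cbin cadd (CProj 1)
       (cbin csub
          (cbin csub (CComp CSucc [CProj 0])
             (cbin cmul (CComp CSucc [CProj 1]) (CComp CSucc [CProj 1])))
          (cconst 1))).

Lemma eval_csqrt n : eval Z csqrt [n] (Nat.sqrt n).
Proof.
  set (G := fun k r => r + (1 - (S r * S r - S k))).
  assert (E : forall m, prec 0 G m = Nat.sqrt m).
  { induction m; [reflexivity|]; simpl; rewrite IHm; unfold G.
    pose proof (Nat.sqrt_spec m (Nat.le_0_l m)) as [H1 H2].
    symmetry; apply Nat.sqrt_unique.
    set (r := Nat.sqrt m) in *; clearbody r.
    destruct (le_lt_dec (S r * S r) (S m)) as [H|H].
    - replace (S r * S r - S m) with 0 by lia; simpl (1 - 0); nia.
    - replace (1 - (S r * S r - S m)) with 0 by lia; nia. }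
  rewrite <- E; apply eval_prec; [constructor|].
  intros k r; unfold G, cbin.
  eapply eval_comp2; [apply eval_proj; reflexivity| |apply eval_cadd].
  eapply eval_comp2; [|apply eval_cconst|apply eval_csub].
  eapply eval_comp2; [apply eval_succ_of, eval_proj; reflexivity| |apply eval_csub].
  eapply eval_comp2; [| |apply eval_cmul]; apply eval_succ_of, eval_proj; reflexivity.
Qed.

(** Unary functions suffice, since several arguments are packed into one with [npair]. *)
Definition rec1 (F : nat -> nat) : Prop := exists c, forall n, eval Z c [n] (F n).

Lemma rec1_ext F G : (forall n, F n = G n) -> rec1 F -> rec1 G.
Proof. intros E [c H]; exists c; intros n; rewrite <- E; apply H. Qed.

Lemma rec1_id : rec1 (fun n => n).
Proof. exists (CProj 0); intros; apply eval_proj; reflexivity. Qed.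

Lemma rec1_const k : rec1 (fun _ => k).
Proof. exists (cconst k); intros; apply eval_cconst. Qed.

Lemma rec1_comp F G : rec1 F -> rec1 G -> rec1 (fun n => F (G n)).
Proof. intros [c H] [d K]; exists (CComp c [d]); intros; eapply eval_comp1; eauto. Qed.

Lemma rec1_bin c op : (forall a b, eval Z c [a; b] (op a b)) ->
  forall F G, rec1 F -> rec1 G -> rec1 (fun n => op (F n) (G n)).
Proof.
  intros Hc F G [f HF] [g HG]; exists (CComp c [f; g]); intros.
  eapply eval_comp2; eauto.
Qed.

Lemma rec1_add F G : rec1 F -> rec1 G -> rec1 (fun n => F n + G n).
Proof. apply (rec1_bin cadd Nat.add eval_cadd). Qed.

Lemma rec1_mul F G : rec1 F -> rec1 G -> rec1 (fun n => F n * G n).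
Proof. apply (rec1_bin cmul Nat.mul eval_cmul). Qed.

Lemma rec1_sub F G : rec1 F -> rec1 G -> rec1 (fun n => F n - G n).
Proof.
  intros HF HG; apply (rec1_bin csub (fun a b => b - a)); auto.
  intros; apply eval_csub.
Qed.

Lemma rec1_sqrt F : rec1 F -> rec1 (fun n => Nat.sqrt (F n)).
Proof. apply rec1_comp; exists csqrt; apply eval_csqrt. Qed.

Lemma rec1_npair F G : rec1 F -> rec1 G -> rec1 (fun n => npair (F n) (G n)).
Proof. intros; unfold npair; auto using rec1_add, rec1_mul. Qed.

Lemma rec1_nfst F : rec1 F -> rec1 (fun n => nfst (F n)).
Proof. intros; unfold nfst; auto using rec1_sub, rec1_mul, rec1_sqrt. Qed.

Lemma rec1_nsnd F : rec1 F -> rec1 (fun n => nsnd (F n)).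
Proof. intros; unfold nsnd; auto using rec1_sub, rec1_nfst, rec1_sqrt. Qed.

Definition cpair := cbin cadd
  (cbin cmul (cbin cadd (CProj 0) (CProj 1)) (cbin cadd (CProj 0) (CProj 1))) (CProj 0).

Lemma eval_cpair a b : eval Z cpair [a; b] (npair a b).
Proof.
  assert (H : eval Z (cbin cadd (CProj 0) (CProj 1)) [a; b] (a + b))
    by (eapply eval_comp2; try (apply eval_proj; reflexivity); apply eval_cadd).
  eapply eval_comp2; [eapply eval_comp2; [exact H|exact H|apply eval_cmul]
    |apply eval_proj; reflexivity|apply eval_cadd].
Qed.

Lemma rec1_prec A G N : rec1 A -> rec1 G -> rec1 N ->
  rec1 (fun n => prec (A n) (fun k r => G (npair n (npair k r))) (N n)).
Proof.
  intros [a HA] [g HG] [c HN].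
  exists (CComp (CPrec a (CComp g [cbin cpair (CProj 2) (cbin cpair (CProj 0) (CProj 1))]))
            [c; CProj 0]).
  intros n; eapply eval_comp2; [apply HN|apply eval_proj; reflexivity|].
  simpl; apply (eval_prec _ _ (fun k r => G (npair n (npair k r)))); [apply HA|].
  intros; eapply eval_comp1; [|apply HG].
  eapply eval_comp2; [apply eval_proj; reflexivity| |apply eval_cpair].
  eapply eval_comp2; try (apply eval_proj; reflexivity); apply eval_cpair.
Qed.

(** Case distinction is a recursion whose step ignores the previous value: every positive number of
    iterations returns [G n]. *)
Lemma rec1_if F G H : rec1 F -> rec1 G -> rec1 H ->
  rec1 (fun n => match F n with 0 => H n | _ => G n end).
Proof.
  intros HF HG HH.
  apply rec1_ext with
    (fun n => prec (H n) (fun k r => G (nfst (npair n (npair k r)))) (F n)).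
  - intros n; destruct (F n); simpl; [reflexivity|now rewrite nfst_npair].
  - apply rec1_prec with (G := fun p => G (nfst p)); auto.
    apply rec1_comp; auto using rec1_nfst, rec1_id.
Qed.

(** Unbounded search serves to find a stage by which [X] has been seen in each open set. The least
    zero is chosen classically, and [CMu] finds exactly that one. *)
Lemma rec1_min F : rec1 F -> (forall x, exists n, F (npair x n) = 0) ->
  exists h, rec1 h /\ forall x, F (npair x (h x)) = 0.
Proof.
  intros [c HF] Hex.
  assert (Hmin : forall x, exists n, F (npair x n) = 0 /\
                   forall m, m < n -> F (npair x m) <> 0).
  { intros x; destruct (Hex x) as [n Hn]; revert Hn.
    induction n as [n IH] using lt_wf_ind; intros Hn.
    destruct (classic (exists m, m < n /\ F (npair x m) = 0)) as [[m [Hm Hm0]]|Hno].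
    - exact (IH m Hm Hm0).
    - exists n; split; [exact Hn|]; intros m Hm Hm0; apply Hno; eauto. }
  exists (fun x => proj1_sig (constructive_indefinite_description _ (Hmin x))).
  split; [|intros x; destruct constructive_indefinite_description; simpl; tauto].
  exists (CMu (CComp c [cbin cpair (CProj 1) (CProj 0)])).
  intros x; destruct constructive_indefinite_description as [n [Hn Hlt]]; simpl.
  assert (Hc : forall m, eval Z (CComp c [cbin cpair (CProj 1) (CProj 0)]) [m; x]
                 (F (npair x m))).
  { intros m; eapply eval_comp1; [|apply HF].
    eapply eval_comp2; try (apply eval_proj; reflexivity); apply eval_cpair. }
  constructor; [generalize (Hc n); now rewrite Hn|].
  intros m Hm; exists (F (npair x m)); split; [now apply Hlt|apply Hc].
Qed.

Lemma rec1_oracle : rec1 (fun n => if Z n then 1 else 0).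
Proof. exists COracle; intros n; apply (ev_oracle Z [n]). Qed.

End Rec.

(** * Encodings of data types *)

Class Enc (T : Type) := enc : T -> nat.

(** The inner [fix] keeps [e] fixed, so that the nested recursion of [enc_code] through [list code]
    is accepted as structural. *)
Definition enc_list {T : Type} (e : T -> nat) : list T -> nat :=
  fix go l := match l with nil => 0 | x :: l => S (npair (e x) (go l)) end.

Fixpoint enc_code (c : code) : nat :=
  match c with
  | CZero => npair 0 0
  | CSucc => npair 1 0
  | CProj i => npair 2 i
  | COracle => npair 3 0
  | CComp f gs => npair 4 (npair (enc_code f) (enc_list enc_code gs))
  | CPrec f g => npair 5 (npair (enc_code f) (enc_code g))
  | CMu f => npair 6 (enc_code f)
  end.

#[export] Instance Enc_nat : Enc nat := fun n => n.
#[export] Instance Enc_bool : Enc bool := fun b => if b then 1 else 0.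
#[export] Instance Enc_prod {T U} `{Enc T} `{Enc U} : Enc (T * U) :=
  fun p => npair (enc (fst p)) (enc (snd p)).
#[export] Instance Enc_sum {T U} `{Enc T} `{Enc U} : Enc (T + U) :=
  fun p => match p with inl x => npair 0 (enc x) | inr y => npair 1 (enc y) end.
#[export] Instance Enc_list {T} `{Enc T} : Enc (list T) := enc_list enc.
#[export] Instance Enc_code : Enc code := enc_code.

(* The realizer [F] is total on [nat], also off the range of [enc], so that the
   branches of a case analysis can all be evaluated before one is selected. *)
Definition cpt (Z : cset) {T U} `{Enc T} `{Enc U} (f : T -> U) : Prop :=
  exists F, rec1 Z F /\ forall x, F (enc x) = enc (f x).

Lemma cpt_oracle Z : cpt Z (Z : nat -> bool).
Proof. exists (fun n => if Z n then 1 else 0); split; [apply rec1_oracle|reflexivity]. Qed.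

Section Cpt.
Variable Z : cset.
Context {T U V W : Type} `{Enc T} `{Enc U} `{Enc V} `{Enc W}.

Lemma cpt_id : cpt Z (fun x : T => x).
Proof. exists (fun n => n); split; [apply rec1_id|reflexivity]. Qed.

Lemma cpt_const (u : U) : cpt Z (fun _ : T => u).
Proof. exists (fun _ => enc u); split; [apply rec1_const|reflexivity]. Qed.

Lemma cpt_comp (g : U -> V) (f : T -> U) : cpt Z g -> cpt Z f -> cpt Z (fun x => g (f x)).
Proof.
  intros [G [HG EG]] [F [HF EF]]; exists (fun n => G (F n)); split.
  - now apply rec1_comp.
  - intros; now rewrite EF, EG.
Qed.

Lemma cpt_pair (f : T -> U) (g : T -> V) : cpt Z f -> cpt Z g -> cpt Z (fun x => (f x, g x)).
Proof.
  intros [F [HF EF]] [G [HG EG]]; exists (fun n => npair (F n) (G n)); split.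
  - now apply rec1_npair.
  - intros; now rewrite EF, EG.
Qed.

Lemma cpt_fst (f : T -> U * V) : cpt Z f -> cpt Z (fun x => fst (f x)).
Proof.
  intros [F [HF EF]]; exists (fun n => nfst (F n)); split; [now apply rec1_nfst|].
  intros; rewrite EF; apply nfst_npair.
Qed.

Lemma cpt_snd (f : T -> U * V) : cpt Z f -> cpt Z (fun x => snd (f x)).
Proof.
  intros [F [HF EF]]; exists (fun n => nsnd (F n)); split; [now apply rec1_nsnd|].
  intros; rewrite EF; apply nsnd_npair.
Qed.

Lemma cpt_if (b : T -> bool) (f g : T -> U) :
  cpt Z b -> cpt Z f -> cpt Z g -> cpt Z (fun x => if b x then f x else g x).
Proof.
  intros [B [HB EB]] [F [HF EF]] [G [HG EG]].
  exists (fun n => match B n with 0 => G n | _ => F n end); split; [now apply rec1_if|].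
  intros x; rewrite EB; destruct (b x); [apply EF|apply EG].
Qed.

Lemma cpt_prec (a : T -> U) (g : T -> nat -> U -> U) (n : T -> nat) :
  cpt Z a -> cpt Z (fun p : T * (nat * U) => g (fst p) (fst (snd p)) (snd (snd p))) ->
  cpt Z n -> cpt Z (fun x => prec (a x) (g x) (n x)).
Proof.
  intros [A [HA EA]] [G [HG EG]] [N [HN EN]].
  exists (fun m => prec (A m) (fun k r => G (npair m (npair k r))) (N m)); split.
  - now apply rec1_prec.
  - intros x; rewrite EN, EA; change (enc (n x)) with (n x).
    induction (n x) as [|k IH]; [reflexivity|].
    simpl; rewrite IH; exact (EG (x, (k, _))).
Qed.

Lemma cpt_S (f : T -> nat) : cpt Z f -> cpt Z (fun x => S (f x)).
Proof.
  intros [F [HF EF]]; exists (fun n => F n + 1); split.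
  - apply rec1_add; [assumption|apply rec1_const].
  - intros; rewrite EF; unfold enc, Enc_nat; lia.
Qed.

Lemma cpt_add (f g : T -> nat) : cpt Z f -> cpt Z g -> cpt Z (fun x => f x + g x).
Proof.
  intros [F [HF EF]] [G [HG EG]]; exists (fun n => F n + G n); split;
    [now apply rec1_add|intros; now rewrite EF, EG].
Qed.

Lemma cpt_sub (f g : T -> nat) : cpt Z f -> cpt Z g -> cpt Z (fun x => f x - g x).
Proof.
  intros [F [HF EF]] [G [HG EG]]; exists (fun n => F n - G n); split;
    [now apply rec1_sub|intros; now rewrite EF, EG].
Qed.

Lemma cpt_mul (f g : T -> nat) : cpt Z f -> cpt Z g -> cpt Z (fun x => f x * g x).
Proof.
  intros [F [HF EF]] [G [HG EG]]; exists (fun n => F n * G n); split;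
    [now apply rec1_mul|intros; now rewrite EF, EG].
Qed.

Lemma cpt_nfst (f : T -> nat) : cpt Z f -> cpt Z (fun x => nfst (f x)).
Proof.
  intros [F [HF EF]]; exists (fun n => nfst (F n)); split; [now apply rec1_nfst|].
  intros; now rewrite EF.
Qed.

Lemma cpt_nsnd (f : T -> nat) : cpt Z f -> cpt Z (fun x => nsnd (f x)).
Proof.
  intros [F [HF EF]]; exists (fun n => nsnd (F n)); split; [now apply rec1_nsnd|].
  intros; now rewrite EF.
Qed.

Lemma cpt_leb (f g : T -> nat) : cpt Z f -> cpt Z g -> cpt Z (fun x => f x <=? g x).
Proof.
  intros [F [HF EF]] [G [HG EG]]; exists (fun n => 1 - (F n - G n)); split.
  - auto using rec1_sub, rec1_const.
  - intros; rewrite EF, EG; unfold enc, Enc_nat, Enc_bool.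
    destruct (Nat.leb_spec (f x) (g x)); lia.
Qed.

Lemma cpt_nat_case (n : T -> nat) (a : T -> U) (b : T -> nat -> U) :
  cpt Z n -> cpt Z a -> cpt Z (fun p : T * nat => b (fst p) (snd p)) ->
  cpt Z (fun x => match n x with 0 => a x | S k => b x k end).
Proof.
  intros [N [HN EN]] [A [HA EA]] [B [HB EB]].
  exists (fun m => match N m with 0 => A m | _ => B (npair m (N m - 1)) end); split.
  - apply (rec1_if Z N (fun m => B (npair m (N m - 1))) A); auto.
    apply rec1_comp; auto using rec1_npair, rec1_id, rec1_sub, rec1_const.
  - intros x; rewrite EN; unfold enc at 1, Enc_nat; destruct (n x); [apply EA|].
    replace (enc (S n0) - 1) with n0 by (unfold enc, Enc_nat; lia).
    exact (EB (x, n0)).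
Qed.

Lemma cpt_ext (f g : T -> U) : (forall x, f x = g x) -> cpt Z f -> cpt Z g.
Proof. intros E [F [HF EF]]; exists F; split; [assumption|]; intros; now rewrite EF, E. Qed.

Lemma cpt_enc (f : T -> U) : cpt Z f -> cpt Z (fun x => enc (f x)).
Proof. intros [F [HF EF]]; exists F; split; [assumption|exact EF]. Qed.

Lemma cpt_prod_case (p : T -> U * V) (b : T -> U -> V -> W) :
  cpt Z p -> cpt Z (fun q : T * (U * V) => b (fst q) (fst (snd q)) (snd (snd q))) ->
  cpt Z (fun x => match p x with (u, v) => b x u v end).
Proof.
  intros [P [HP EP]] [B [HB EB]].
  exists (fun n => B (npair n (P n))); split.
  - apply rec1_comp; auto using rec1_npair, rec1_id.
  - intros x; rewrite EP; refine (eq_trans (EB (x, p x)) _); simpl; now destruct (p x).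
Qed.

Lemma cpt_inl (f : T -> U) : cpt Z f -> cpt Z (fun x => @inl U V (f x)).
Proof.
  intros [F [HF EF]]; exists (fun n => npair 0 (F n)); split.
  - auto using rec1_npair, rec1_const.
  - intros; now rewrite EF.
Qed.

Lemma cpt_inr (f : T -> V) : cpt Z f -> cpt Z (fun x => @inr U V (f x)).
Proof.
  intros [F [HF EF]]; exists (fun n => npair 1 (F n)); split.
  - auto using rec1_npair, rec1_const.
  - intros; now rewrite EF.
Qed.

Lemma cpt_sum_case (p : T -> U + V) (a : T -> U -> W) (b : T -> V -> W) :
  cpt Z p -> cpt Z (fun q : T * U => a (fst q) (snd q)) ->
  cpt Z (fun q : T * V => b (fst q) (snd q)) ->
  cpt Z (fun x => match p x with inl u => a x u | inr v => b x v end).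
Proof.
  intros [P [HP EP]] [A [HA EA]] [B [HB EB]].
  exists (fun n => match nfst (P n) with
                   | 0 => A (npair n (nsnd (P n)))
                   | _ => B (npair n (nsnd (P n)))
                   end); split.
  - apply (rec1_if Z (fun n => nfst (P n)) (fun n => B (npair n (nsnd (P n))))
             (fun n => A (npair n (nsnd (P n))))); auto using rec1_nfst;
    apply rec1_comp; auto using rec1_npair, rec1_id, rec1_nsnd.
  - intros x; rewrite EP; destruct (p x) as [u|v]; unfold enc at 1, Enc_sum at 1;
      rewrite nfst_npair; unfold enc at 2, Enc_sum; rewrite nsnd_npair.
    + exact (EA (x, u)).
    + exact (EB (x, v)).
Qed.

Lemma cpt_cons (f : T -> U) (g : T -> list U) :
  cpt Z f -> cpt Z g -> cpt Z (fun x => f x :: g x).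
Proof.
  intros [F [HF EF]] [G [HG EG]]; exists (fun n => npair (F n) (G n) + 1); split.
  - auto using rec1_add, rec1_npair, rec1_const.
  - intros; rewrite EF, EG, Nat.add_1_r; reflexivity.
Qed.

Lemma cpt_list_case (l : T -> list U) (a : T -> V) (b : T -> U -> list U -> V) :
  cpt Z l -> cpt Z a ->
  cpt Z (fun p : T * (U * list U) => b (fst p) (fst (snd p)) (snd (snd p))) ->
  cpt Z (fun x => match l x with nil => a x | h :: t => b x h t end).
Proof.
  intros [L [HL EL]] [A [HA EA]] [B [HB EB]].
  exists (fun m => match L m with 0 => A m | _ => B (npair m (L m - 1)) end); split.
  - apply (rec1_if Z L (fun m => B (npair m (L m - 1))) A); auto.
    apply rec1_comp; auto using rec1_npair, rec1_id, rec1_sub, rec1_const.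
  - intros x; rewrite EL; destruct (l x) as [|h t]; [apply EA|].
    replace (enc (h :: t) - 1) with (enc (h, t))
      by (change (enc (h :: t)) with (S (npair (enc h) (enc t))); unfold enc at 1, Enc_prod;
          simpl; lia).
    exact (EB (x, (h, t))).
Qed.

Lemma cpt_code_case (c : T -> code) (a0 a1 a3 : T -> U) (a2 : T -> nat -> U)
    (a4 : T -> code -> list code -> U) (a5 : T -> code -> code -> U) (a6 : T -> code -> U) :
  cpt Z c -> cpt Z a0 -> cpt Z a1 -> cpt Z (fun p : T * nat => a2 (fst p) (snd p)) ->
  cpt Z a3 ->
  cpt Z (fun p : T * (code * list code) => a4 (fst p) (fst (snd p)) (snd (snd p))) ->
  cpt Z (fun p : T * (code * code) => a5 (fst p) (fst (snd p)) (snd (snd p))) ->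
  cpt Z (fun p : T * code => a6 (fst p) (snd p)) ->
  cpt Z (fun x => match c x with
                  | CZero => a0 x | CSucc => a1 x | CProj i => a2 x i | COracle => a3 x
                  | CComp f gs => a4 x f gs | CPrec f g => a5 x f g | CMu f => a6 x f end).
Proof.
  intros [C [HC EC]] [A0 [K0 E0]] [A1 [K1 E1]] [A2 [K2 E2]] [A3 [K3 E3]] [A4 [K4 E4]]
    [A5 [K5 E5]] [A6 [K6 E6]].
  set (P := fun n => npair n (nsnd (C n))).
  assert (HP : rec1 Z P) by (apply rec1_npair; auto using rec1_id, rec1_nsnd).
  (* The test against [k] is reached only when the tag is at least [k], so truncated subtraction
     decides equality. *)
  exists (fun n => match nfst (C n) with 0 => A0 n | _ =>
           match nfst (C n) - 1 with 0 => A1 n | _ =>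
           match nfst (C n) - 2 with 0 => A2 (P n) | _ =>
           match nfst (C n) - 3 with 0 => A3 n | _ =>
           match nfst (C n) - 4 with 0 => A4 (P n) | _ =>
           match nfst (C n) - 5 with 0 => A5 (P n) | _ => A6 (P n) end end end end end end).
  split.
  - assert (HT : forall k, rec1 Z (fun n => nfst (C n) - k))
      by (intros; auto using rec1_sub, rec1_nfst, rec1_const).
    apply (rec1_if Z (fun n => nfst (C n)) _ A0); auto using rec1_nfst.
    apply (rec1_if Z (fun n => nfst (C n) - 1) _ A1); auto.
    apply (rec1_if Z (fun n => nfst (C n) - 2) _ (fun n => A2 (P n))); auto using rec1_comp.
    apply (rec1_if Z (fun n => nfst (C n) - 3) _ A3); auto.
    apply (rec1_if Z (fun n => nfst (C n) - 4) _ (fun n => A4 (P n))); auto using rec1_comp.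
    apply (rec1_if Z (fun n => nfst (C n) - 5) (fun n => A6 (P n)) (fun n => A5 (P n)));
      auto using rec1_comp.
  - intros x; unfold P; rewrite EC.
    destruct (c x) as [| |i| |f gs|f g|f]; unfold enc, Enc_code; cbn [enc_code];
      rewrite nfst_npair; cbn [Nat.sub]; rewrite ?nsnd_npair;
      [exact (E0 x)|exact (E1 x)|exact (E2 (x, i))|exact (E3 x)|exact (E4 (x, (f, gs)))
      |exact (E5 (x, (f, g)))|exact (E6 (x, f))].
Qed.

End Cpt.

Lemma cpt_app2 Z {T U V W} `{Enc T} `{Enc U} `{Enc V} `{Enc W} (g : U -> V -> W)
    (f : T -> U) (h : T -> V) :
  cpt Z (fun p => g (fst p) (snd p)) -> cpt Z f -> cpt Z h -> cpt Z (fun x => g (f x) (h x)).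
Proof. intros Hg Hf Hh; apply (cpt_comp Z _ (fun x => (f x, h x)) Hg); auto using cpt_pair. Qed.

Lemma cpt_app3 Z {T U V W Q} `{Enc T} `{Enc U} `{Enc V} `{Enc W} `{Enc Q} (g : U -> V -> W -> Q)
    (f : T -> U) (h : T -> V) (k : T -> W) :
  cpt Z (fun p => g (fst p) (fst (snd p)) (snd (snd p))) -> cpt Z f -> cpt Z h -> cpt Z k ->
  cpt Z (fun x => g (f x) (h x) (k x)).
Proof.
  intros Hg Hf Hh Hk; apply (cpt_comp Z _ (fun x => (f x, (h x, k x))) Hg).
  auto using cpt_pair.
Qed.

(** A hook of the tactic, rebound when further closure lemmas become available. *)
Ltac cpt_user := fail.

Ltac cpt_hyp :=
  match goal with
  | H : cpt ?Z ?f |- cpt ?Z (fun x => ?f (@?g x)) => eapply (cpt_comp Z f g H)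
  | H : cpt ?Z (fun p => ?g (fst p) (snd p)) |- cpt ?Z (fun x => ?g _ _) =>
      eapply (cpt_app2 Z g _ _ H)
  | H : cpt ?Z (fun p => ?g (fst p) (fst (snd p)) (snd (snd p)))
    |- cpt ?Z (fun x => ?g _ _ _) => eapply (cpt_app3 Z g _ _ _ H)
  end.

(** The head symbol of the body selects the closure lemma; the last case eta-expands a function so
    that its body becomes visible. *)
Ltac cpt_step :=
  lazymatch goal with
  | |- Enc _ => typeclasses eauto
  | |- cpt _ (fun _ => ?c) => simple apply cpt_const
  | |- cpt _ (fun x => x) => simple apply cpt_id
  | |- cpt _ (fun x => (_, _)) => eapply cpt_pair
  | |- cpt _ (fun x => fst _) => eapply cpt_fst
  | |- cpt _ (fun x => snd _) => eapply cpt_snd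
  | |- cpt _ (fun x => match _ with true => _ | false => _ end) => eapply cpt_if
  | |- cpt _ (fun x => prec _ _ _) => eapply cpt_prec
  | |- cpt _ (fun x => S _) => eapply cpt_S
  | |- cpt _ (fun x => _ + _) => eapply cpt_add
  | |- cpt _ (fun x => _ - _) => eapply cpt_sub
  | |- cpt _ (fun x => _ * _) => eapply cpt_mul
  | |- cpt _ (fun x => nfst _) => eapply cpt_nfst
  | |- cpt _ (fun x => nsnd _) => eapply cpt_nsnd
  | |- cpt _ (fun x => _ <=? _) => eapply cpt_leb
  | |- cpt _ (fun x => inl _) => eapply cpt_inl
  | |- cpt _ (fun x => inr _) => eapply cpt_inr
  | |- cpt _ (fun x => _ :: _) => eapply cpt_cons
  | |- cpt _ (fun x => match _ with 0 => _ | S _ => _ end) => eapply cpt_nat_case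
  | |- cpt _ (fun x => match _ with (_, _) => _ end) => eapply cpt_prod_case
  | |- cpt _ (fun x => match _ with inl _ => _ | inr _ => _ end) => eapply cpt_sum_case
  | |- cpt _ (fun x => match _ with nil => _ | _ :: _ => _ end) => eapply cpt_list_case
  | |- cpt _ (fun x => match _ with CMu _ => _ | _ => _ end) => eapply cpt_code_case
  | |- cpt _ (fun x => _) => first [eassumption | cpt_user | cpt_hyp]
  | |- cpt ?Z ?f => first [eassumption | change (cpt Z (fun x => f x))]
  end.

Ltac cpt := repeat (cbn beta; cpt_step).

(** * Recursion over lists and strings *)

Section CptDerived.
Variable Z : cset.
Context {T U V : Type} `{Enc T} `{Enc U} `{Enc V}.

Lemma cpt_andb (f g : T -> bool) : cpt Z f -> cpt Z g -> cpt Z (fun x => f x && g x)%bool.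
Proof. intros; unfold andb; cpt. Qed.

Lemma cpt_negb (f : T -> bool) : cpt Z f -> cpt Z (fun x => negb (f x)).
Proof. intros; unfold negb; cpt. Qed.

(** The code of a list thus serves as the number of recursion steps that consume it. *)
Lemma length_le_enc (l : list U) : length l <= enc l.
Proof.
  induction l as [|x l IH]; [simpl; lia|].
  change (enc (x :: l)) with (S (npair (enc x) (enc l))).
  pose proof (npair_ge_snd (enc x) (enc l)); simpl; lia.
Qed.

(** The state pairs the unread part of the list with the accumulator. On an empty list the step
    idles, so surplus iterations are harmless. *)
Definition fold_step (g : V -> U -> V) (_ : nat) (s : list U * V) : list U * V :=
  match fst s with nil => s | h :: t => (t, g (snd s) h) end.

Lemma fold_left_prec (g : V -> U -> V) l a n : length l <= n ->
  snd (prec (l, a) (fold_step g) n) = fold_left g l a.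
Proof.
  (* [prec] adds its steps on the outside, while the list is consumed from the inside; the step
     ignores its counter, so one step can be moved across. *)
  assert (comm : forall n s, prec (fold_step g 0 s) (fold_step g) n
                        = fold_step g 0 (prec s (fold_step g) n)).
  { intros m; induction m; intros s; simpl; [reflexivity|now rewrite IHm]. }
  revert l a; induction n as [|n IH]; intros l a Hl.
  - destruct l; [reflexivity|simpl in Hl; lia].
  - simpl; change (fold_step g n) with (fold_step g 0); rewrite <- comm.
    destruct l as [|x l]; [apply IH; simpl; lia|].
    exact (IH l (g a x) (le_S_n _ _ Hl)).
Qed.

Lemma cpt_fold_left (g : T -> V -> U -> V) (l : T -> list U) (a : T -> V) :
  cpt Z (fun p : T * (V * U) => g (fst p) (fst (snd p)) (snd (snd p))) ->
  cpt Z l -> cpt Z a -> cpt Z (fun x => fold_left (g x) (l x) (a x)).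
Proof.
  intros Hg Hl Ha.
  apply cpt_ext with (fun x => snd (prec (l x, a x) (fold_step (g x)) (enc (l x)))).
  - intros x; apply fold_left_prec, length_le_enc.
  - unfold fold_step; eapply cpt_snd, cpt_prec; [cpt| |now apply cpt_enc].
    cpt.
Qed.

End CptDerived.

Ltac cpt_user ::=
  lazymatch goal with
  | |- cpt _ (fun x => andb _ _) => eapply cpt_andb
  | |- cpt _ (fun x => negb _) => eapply cpt_negb
  | |- cpt _ (fun x => fold_left _ _ _) => eapply cpt_fold_left
  end.

Definition tab {U} (f : nat -> U) (n : nat) : list U := map f (seq 0 n).
Definition forallb_lt (n : nat) (p : nat -> bool) : bool := forallb p (seq 0 n).
Definition existsb_lt (n : nat) (p : nat -> bool) : bool := existsb p (seq 0 n).
Definition count {U} (p : U -> bool) (l : list U) : nat := length (filter p l).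

Fixpoint strs (n : nat) : list (list bool) :=
  match n with
  | 0 => [[]]
  | S n => map (cons false) (strs n) ++ map (cons true) (strs n)
  end.

Lemma seq_0_S n : seq 0 (S n) = seq 0 n ++ [n].
Proof. now rewrite seq_S. Qed.

Lemma fold_left_cons {U} (l a : list U) :
  fold_left (fun acc y => y :: acc) l a = rev l ++ a.
Proof. revert a; induction l; intros; simpl; [easy|]; now rewrite IHl, <- app_assoc. Qed.

Section ListFunctions.
Variable Z : cset.
Context {T U : Type} `{Enc T} `{Enc U}.

Lemma cpt_rev (f : T -> list U) : cpt Z f -> cpt Z (fun x => rev (f x)).
Proof.
  intros; apply cpt_ext with (fun x => fold_left (fun acc y => y :: acc) (f x) []); [|cpt].
  intros; now rewrite fold_left_cons, app_nil_r.
Qed.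

Lemma cpt_app (f g : T -> list U) : cpt Z f -> cpt Z g -> cpt Z (fun x => f x ++ g x).
Proof.
  intros; apply cpt_ext with (fun x => fold_left (fun acc y => y :: acc) (rev (f x)) (g x)).
  - intros; now rewrite fold_left_cons, rev_involutive.
  - eapply cpt_fold_left; [cpt|now apply cpt_rev|cpt].
Qed.

Lemma cpt_length (f : T -> list U) : cpt Z f -> cpt Z (fun x => length (f x)).
Proof.
  intros; apply cpt_ext with (fun x => fold_left (fun n _ => S n) (f x) 0); [|cpt].
  intros x; rewrite <- (Nat.add_0_r (length (f x))); generalize 0.
  induction (f x) as [|y l IH]; intros n; simpl; [easy|]; rewrite IH; lia.
Qed.

Lemma cpt_hd d (f : T -> list U) : cpt Z f -> cpt Z (fun x => hd d (f x)).
Proof. intros; unfold hd; cpt. Qed.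

Lemma cpt_nth d (i : T -> nat) (f : T -> list U) :
  cpt Z i -> cpt Z f -> cpt Z (fun x => nth (i x) (f x) d).
Proof.
  intros; apply cpt_ext with (fun x => hd d (prec (f x) (fun _ => @tl U) (i x))).
  - intros x; generalize (f x); induction (i x) as [|n IH]; intros l; simpl; [now destruct l|].
    assert (E : forall m (l : list U),
              prec (tl l) (fun _ => @tl U) m = tl (prec l (fun _ => @tl U) m))
      by (clear; induction m; intros; simpl; [easy|now rewrite IHm]).
    rewrite <- E, IH; destruct l, n; reflexivity.
  - apply cpt_hd; unfold tl; cpt.
Qed.

End ListFunctions.

Section ListIterators.
Variable Z : cset.
Context {T U V : Type} `{Enc T} `{Enc U} `{Enc V}.

Lemma cpt_map (g : T -> U -> V) (l : T -> list U) :
  cpt Z (fun p : T * U => g (fst p) (snd p)) -> cpt Z l -> cpt Z (fun x => map (g x) (l x)).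
Proof.
  intros Hg Hl.
  apply cpt_ext with (fun x => rev (fold_left (fun acc y => g x y :: acc) (l x) [])).
  - intros x; rewrite <- (rev_involutive (map (g x) (l x))); f_equal.
    rewrite <- (app_nil_r (rev _)); generalize (@nil V).
    induction (l x) as [|y t IH]; intros a; simpl; [easy|]; now rewrite IH, <- app_assoc.
  - apply cpt_rev; eapply cpt_fold_left; [|cpt|cpt].
    cpt.
Qed.

Lemma cpt_count (p : T -> U -> bool) (l : T -> list U) :
  cpt Z (fun q : T * U => p (fst q) (snd q)) -> cpt Z l -> cpt Z (fun x => count (p x) (l x)).
Proof.
  intros Hp Hl.
  apply cpt_ext with (fun x => fold_left (fun n y => if p x y then S n else n) (l x) 0).
  - intros x; unfold count; rewrite <- (Nat.add_0_r (length _)); generalize 0.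
    induction (l x) as [|y t IH]; intros a; simpl; [easy|]; rewrite IH.
    destruct (p x y); simpl; lia.
  - cpt.
Qed.

Lemma cpt_tab (g : T -> nat -> U) (n : T -> nat) :
  cpt Z (fun p : T * nat => g (fst p) (snd p)) -> cpt Z n -> cpt Z (fun x => tab (g x) (n x)).
Proof.
  intros Hg Hn.
  apply cpt_ext with (fun x => prec [] (fun k r => r ++ [g x k]) (n x)).
  - intros x; unfold tab; induction (n x) as [|k IH]; [easy|].
    rewrite seq_0_S, map_app; simpl; now rewrite IH.
  - eapply cpt_prec; [cpt| |cpt].
    eapply cpt_app; cpt.
Qed.

Lemma cpt_forallb_lt (p : T -> nat -> bool) (n : T -> nat) :
  cpt Z (fun q : T * nat => p (fst q) (snd q)) -> cpt Z n ->
  cpt Z (fun x => forallb_lt (n x) (p x)).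
Proof.
  intros Hp Hn.
  apply cpt_ext with (fun x => prec true (fun k r => if r then p x k else false) (n x)).
  - intros x; unfold forallb_lt; induction (n x) as [|k IH]; [easy|].
    rewrite seq_0_S, forallb_app; simpl; rewrite IH.
    destruct (forallb _ _); simpl; [now rewrite Bool.andb_true_r|easy].
  - cpt.
Qed.

Lemma cpt_existsb_lt (p : T -> nat -> bool) (n : T -> nat) :
  cpt Z (fun q : T * nat => p (fst q) (snd q)) -> cpt Z n ->
  cpt Z (fun x => existsb_lt (n x) (p x)).
Proof.
  intros Hp Hn.
  apply cpt_ext with (fun x => prec false (fun k r => if r then true else p x k) (n x)).
  - intros x; unfold existsb_lt; induction (n x) as [|k IH]; [easy|].
    rewrite seq_0_S, existsb_app; simpl; rewrite IH.
    destruct (existsb _ _); simpl; [easy|now rewrite Bool.orb_false_r].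
  - cpt.
Qed.

End ListIterators.

Section Strings.
Variable Z : cset.
Context {T : Type} `{Enc T}.

Lemma cpt_strs (n : T -> nat) : cpt Z n -> cpt Z (fun x => strs (n x)).
Proof.
  intros Hn.
  apply cpt_ext with
    (fun x => prec [[]] (fun _ r => map (cons false) r ++ map (cons true) r) (n x)).
  - intros x; induction (n x) as [|k IH]; simpl; [easy|now rewrite IH].
  - eapply cpt_prec; [cpt| |cpt].
    eapply cpt_app; eapply cpt_map with (g := fun _ => cons _); cpt.
Qed.

Lemma cpt_pow (a : nat) (n : T -> nat) : cpt Z n -> cpt Z (fun x => a ^ n x).
Proof.
  intros Hn; apply cpt_ext with (fun x => prec 1 (fun _ r => a * r) (n x)); [|cpt].
  intros x; induction (n x) as [|k IH]; simpl; [easy|now rewrite IH].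
Qed.

Lemma cpt_eqb (f g : T -> nat) : cpt Z f -> cpt Z g -> cpt Z (fun x => f x =? g x).
Proof.
  intros; apply cpt_ext with (fun x => andb (f x <=? g x) (g x <=? f x)); [|cpt].
  intros x; destruct (Nat.eqb_spec (f x) (g x)), (Nat.leb_spec (f x) (g x)),
    (Nat.leb_spec (g x) (f x)); simpl; lia.
Qed.

Lemma cpt_str_code (f : T -> list bool) : cpt Z f -> cpt Z (fun x => str_code (f x)).
Proof.
  intros Hf.
  apply cpt_ext with
    (fun x => fold_left (fun r b => if (b : bool) then S (S (2 * r)) else S (2 * r)) (rev (f x)) 0).
  - intros x.
    rewrite <- (fold_left_rev_right
      (fun b r => if (b : bool) then S (S (2 * r)) else S (2 * r))), rev_involutive.
    induction (f x) as [|[] l IH]; cbn [fold_right str_code]; [easy| |]; now rewrite IH.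
  - eapply cpt_fold_left; [cpt|now apply cpt_rev|cpt].
Qed.

End Strings.

Ltac cpt_user ::=
  lazymatch goal with
  | |- cpt _ (fun x => andb _ _) => eapply cpt_andb
  | |- cpt _ (fun x => negb _) => eapply cpt_negb
  | |- cpt _ (fun x => fold_left _ _ _) => eapply cpt_fold_left
  | |- cpt _ (fun x => rev _) => eapply cpt_rev
  | |- cpt _ (fun x => _ ++ _) => eapply cpt_app
  | |- cpt _ (fun x => length _) => eapply cpt_length
  | |- cpt _ (fun x => hd _ _) => eapply cpt_hd
  | |- cpt _ (fun x => nth _ _ _) => eapply cpt_nth
  | |- cpt _ (fun x => map _ _) => eapply cpt_map
  | |- cpt _ (fun x => count _ _) => eapply cpt_count
  | |- cpt _ (fun x => tab _ _) => eapply cpt_tab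
  | |- cpt _ (fun x => forallb_lt _ _) => eapply cpt_forallb_lt
  | |- cpt _ (fun x => existsb_lt _ _) => eapply cpt_existsb_lt
  | |- cpt _ (fun x => strs _) => eapply cpt_strs
  | |- cpt _ (fun x => _ ^ _) => eapply cpt_pow
  | |- cpt _ (fun x => _ =? _) => eapply cpt_eqb
  | |- cpt _ (fun x => str_code _) => eapply cpt_str_code
  end.

Lemma str_code_inj s t : str_code s = str_code t -> s = t.
Proof.
  revert t; induction s as [|b s IH]; intros [|b' t]; simpl;
    try (destruct b); try (destruct b'); intros E; try lia; f_equal; apply IH; lia.
Qed.

Lemma length_le_str_code s : length s <= str_code s.
Proof. induction s as [|[] s IH]; simpl; lia. Qed.

Lemma in_strs n s : In s (strs n) <-> length s = n.
Proof.
  revert s; induction n as [|n IH]; intros s; simpl.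
  - destruct s; simpl; split; try easy; [now left|intros [|[]]; discriminate].
  - rewrite in_app_iff, !in_map_iff; split.
    + intros [[t [<- Ht]]|[t [<- Ht]]]; simpl; f_equal; now apply IH.
    + destruct s as [|[] s]; simpl; intros E; try discriminate; injection E as E;
        [right|left]; exists s; split; auto; now apply IH.
Qed.

(** Exhaustive search suffices: a string is no longer than its code, so it occurs among the strings
    of length at most [n]. *)
Definition str_dec (n : nat) : list bool :=
  fold_left (fun a s => if str_code s =? n then s else a)
    (fold_left (fun r k => strs k ++ r) (tab (fun k => k) (S n)) []) [].

Lemma str_dec_code s : str_dec (str_code s) = s.
Proof.
  unfold str_dec.
  assert (Hin : forall l r, In s r \/ In (length s) l ->
            In s (fold_left (fun r k => strs k ++ r) l r)).
  { induction l as [|k l IH]; intros r; simpl; [intuition|].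
    intros Hs; apply IH; rewrite in_app_iff, in_strs.
    destruct Hs as [|[->|]]; auto. }
  assert (H : In s (fold_left (fun r k => strs k ++ r) (tab (fun k => k) (S (str_code s))) [])).
  { apply Hin; right; unfold tab; rewrite map_id, in_seq.
    pose proof (length_le_str_code s); lia. }
  revert H; generalize (fold_left (fun r k => strs k ++ r) (tab (fun k => k) (S (str_code s))) []).
  intros l Hl.
  assert (G : forall l a, a = s \/ In s l ->
            fold_left (fun a t => if str_code t =? str_code s then t else a) l a = s).
  { clear; induction l as [|t l IH]; intros a; simpl; [tauto|].
    intros Ha; apply IH; destruct (Nat.eqb_spec (str_code t) (str_code s)) as [E|E].
    - left; now apply str_code_inj.
    - destruct Ha as [->|[->|]]; auto; now destruct E. }
  apply G; auto.
Qed.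

Lemma cpt_str_dec Z : cpt Z str_dec.
Proof. unfold str_dec; cpt. Qed.

(** * Relativization and a universal machine *)

Section Relativization.
Variables (A Z : cset) (d : code).
Hypothesis Hd : forall l, eval Z d l (if A (hd 0 l) then 1 else 0).

Fixpoint subst_oracle (c : code) : code :=
  match c with
  | COracle => d
  | CComp f gs => CComp (subst_oracle f) (map subst_oracle gs)
  | CPrec f g => CPrec (subst_oracle f) (subst_oracle g)
  | CMu f => CMu (subst_oracle f)
  | c => c
  end.

Lemma eval_subst_oracle : forall c l y, eval A c l y -> eval Z (subst_oracle c) l y.
Proof.
  (* A hand-written mutual fixpoint, because the generated induction principle gives no hypothesis
     for the evaluations inside the existential of [ev_mu], nor for [evals]. *)
  fix IH 4 with (IHs gs l ys (H : evals A gs l ys) {struct H} :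
    evals Z (map subst_oracle gs) l ys).
  - intros c l y H; destruct H; simpl; try (econstructor; eauto; fail); auto.
    { eapply ev_precS; [exact (IH _ _ _ H)|now apply IH]. }
    constructor; [now apply IH|].
    intros m Hm; destruct (H0 m Hm) as [v [Hv E]]; exists v; split; [exact Hv|now apply IH].
  - intros gs l ys H; destruct H; simpl; constructor; auto.
Qed.

End Relativization.

(* [CProj 0] reads the head with the default 0, so that [CComp d [CProj 0]] is
   defined on argument lists of every length, as an oracle call is. *)
Lemma cpt_relativize (A Z : cset) {T U} `{Enc T} `{Enc U} (f : T -> U) :
  turing_le A Z -> cpt A f -> cpt Z f.
Proof.
  intros [d Hd] [F [[c Hc] EF]]; exists F; split; [|exact EF].
  exists (subst_oracle (CComp d [CProj 0]) c); intros n.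
  apply (eval_subst_oracle A); [|apply Hc].
  intros l; eapply eval_comp1; [constructor|].
  replace (nth 0 l 0) with (hd 0 l) by now destruct l.
  apply Hd.
Qed.

(** * An abstract machine with an oracle *)

Definition frame : Type :=
  (code * (list code * (list nat * list nat)))
  + ((code * (nat * list nat)) + (code * (nat * list nat))).
Definition mstate : Type := ((code * list nat) + nat) * list frame.

(* A state either evaluates a code on arguments or returns a value to a stack.
   Frames: [inl (f, (gs, (l, acc)))] collects in [acc] the reversed values of the
   arguments of [f]; [inr (inl (g, (n, l)))] continues a primitive recursion;
   [inr (inr (f, (n, l)))] continues an unbounded search at [n]. *)
Definition mstep (A : cset) (st : mstate) : mstate :=
  let '(m, K) := st in
  match m with
  | inl (c, l) =>
      match c with
      | CZero => (inr 0, K)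
      | CSucc => (inr (S (hd 0 l)), K)
      | CProj i => (inr (nth i l 0), K)
      | COracle => (inr (if A (hd 0 l) then 1 else 0), K)
      | CComp f gs =>
          match gs with
          | nil => (inl (f, nil), K)
          | g :: gs => (inl (g, l), inl (f, (gs, (l, nil))) :: K)
          end
      | CPrec f g =>
          match l with
          | nil => st
          | n :: l =>
              match n with
              | 0 => (inl (f, l), K)
              | S n => (inl (c, n :: l), inr (inl (g, (n, l))) :: K)
              end
          end
      | CMu f => (inl (f, 0 :: l), inr (inr (f, (0, l))) :: K)
      end
  | inr v =>
      match K with
      | nil => st
      | F :: K =>
          match F with
          | inl (f, (gs, (l, acc))) =>
              match gs with
              | nil => (inl (f, rev (v :: acc)), K)
              | g :: gs => (inl (g, l), inl (f, (gs, (l, v :: acc))) :: K)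
              end
          | inr F =>
              match F with
              | inl (g, (n, l)) => (inl (g, n :: v :: l), K)
              | inr (f, (n, l)) =>
                  match v with
                  | 0 => (inr n, K)
                  | S _ => (inl (f, S n :: l), inr (inr (f, (S n, l))) :: K)
                  end
              end
          end
      end
  end.

Definition mrun (A : cset) (st : mstate) (k : nat) : mstate :=
  prec st (fun _ => mstep A) k.

Definition halted (st : mstate) : bool :=
  match fst st with
  | inl _ => false
  | inr _ => match snd st with nil => true | _ :: _ => false end
  end.

Lemma cpt_mstep A : cpt A (mstep A).
Proof.
  unfold mstep, mstate, frame; pose proof (cpt_oracle A) as HA; cpt.
Qed.

Section Machine.
Variable A : cset.

Lemma mrun_add st j k : mrun A (mrun A st j) k = mrun A st (k + j).
Proof. unfold mrun; induction k; simpl; [easy|now rewrite IHk]. Qed.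

Definition reaches (st st' : mstate) : Prop := exists k, mrun A st k = st'.

Lemma reaches_refl st : reaches st st.
Proof. now exists 0. Qed.

Lemma reaches_trans s1 s2 s3 : reaches s1 s2 -> reaches s2 s3 -> reaches s1 s3.
Proof. intros [j <-] [k <-]; exists (k + j); now rewrite mrun_add. Qed.

Lemma reaches_step s1 s2 : reaches (mstep A s1) s2 -> reaches s1 s2.
Proof. apply reaches_trans; now exists 1. Qed.

Lemma reaches_mu f l n K :
  (forall K, reaches (inl (f, n :: l), K) (inr 0, K)) ->
  (forall m, m < n -> exists v, v <> 0 /\ forall K, reaches (inl (f, m :: l), K) (inr v, K)) ->
  forall d j, j + d = n ->
  reaches (inl (f, j :: l), inr (inr (f, (j, l))) :: K) (inr n, K).
Proof.
  intros H0 Hlt; induction d as [|d IH]; intros j Hj.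
  - rewrite Nat.add_0_r in Hj; subst j.
    eapply reaches_trans; [apply H0|apply reaches_step, reaches_refl].
  - destruct (Hlt j) as [v [Hv Hr]]; [lia|].
    eapply reaches_trans; [apply Hr|apply reaches_step].
    destruct v; [easy|]; apply IH; lia.
Qed.

(** The arbitrary stack lets the evaluation of a subterm run above pending frames. For argument
    lists the induction starts from a frame about to receive [v], the value of the preceding
    argument. *)
Lemma eval_reaches : forall c l y, eval A c l y ->
  forall K, reaches (inl (c, l), K) (inr y, K).
Proof.
  fix IH 4 with (IHs gs l ys (H : evals A gs l ys) {struct H} : forall f acc v K,
    reaches (inr v, inl (f, (gs, (l, acc))) :: K) (inl (f, rev (v :: acc) ++ ys), K)).
  - intros c l y H K; destruct H.
    1-4: apply reaches_step, reaches_refl.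
    + apply reaches_step; destruct H; simpl; [now apply IH|].
      eapply reaches_trans; [apply IH; eassumption|].
      eapply reaches_trans; [apply IHs; eassumption|].
      now apply IH.
    + apply reaches_step; now apply IH.
    + apply reaches_step; simpl.
      eapply reaches_trans; [apply IH; eassumption|].
      apply reaches_step; now apply IH.
    + apply reaches_step; simpl.
      apply reaches_mu with n; [intros; now apply IH| |reflexivity].
      intros m Hm; destruct (H0 m Hm) as [v [Hv E]]; exists v; split; [exact Hv|].
      intros; now apply IH.
  - intros gs l ys H; destruct H; intros f acc v K; apply reaches_step.
    + simpl; rewrite app_nil_r; apply reaches_refl.
    + eapply reaches_trans; [apply IH; eassumption|].
      replace (rev (v :: acc) ++ y :: ys) with (rev (y :: v :: acc) ++ ys)
        by (simpl; now rewrite <- !app_assoc).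
      now apply IHs.
Qed.

(* [goodK K v]: returning [v] to the stack [K] leads to termination. *)
Fixpoint goodK (K : list frame) (v : nat) : Prop :=
  match K with
  | nil => True
  | inl (f, (gs, (l, acc))) :: K =>
      exists ys y, evals A gs l ys /\ eval A f (rev acc ++ v :: ys) y /\ goodK K y
  | inr (inl (g, (n, l))) :: K => exists y, eval A g (n :: v :: l) y /\ goodK K y
  | inr (inr (f, (n, l))) :: K =>
      exists y, ((forall m, m < n -> exists u, u <> 0 /\ eval A f (m :: l) u) ->
                 eval A f (n :: l) v -> eval A (CMu f) l y) /\ goodK K y
  end.

Definition good (st : mstate) : Prop :=
  match st with
  | (inl (c, l), K) => exists v, eval A c l v /\ goodK K v
  | (inr v, K) => goodK K v
  end.

(** Goodness is pulled back against the computation: a halted state is trivially good, and at the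
    initial state goodness says that a value exists. *)
Lemma good_mstep st : good (mstep A st) -> good st.
Proof.
  destruct st as [[[c l]|v] K].
  - destruct c as [| |i| |f gs|f g|f]; simpl.
    1-4: intros HK; eexists; split; [constructor|exact HK].
    + destruct gs as [|g gs]; simpl.
      * intros [v [Hv HK]]; exists v; split; [|exact HK]; econstructor; [constructor|exact Hv].
      * intros [v [Hv [ys [y [Hys [Hf HK]]]]]]; exists y; split; [|exact HK].
        econstructor; [constructor; eassumption|exact Hf].
    + destruct l as [|[|n] l]; simpl; [easy| |].
      * intros [v [Hv HK]]; exists v; split; [now constructor|exact HK].
      * intros [v [Hv [y [Hy HK]]]]; exists y; split; [econstructor; eassumption|exact HK].
    + intros [v [Hv [y [Hy HK]]]]; exists y; split; [|exact HK].
      apply Hy; [intros; lia|exact Hv].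
  - destruct K as [|[[f [gs [l acc]]]|[[g [n l]]|[f [n l]]]] K]; simpl; [easy| | |].
    + destruct gs as [|g gs]; simpl.
      * intros [y [Hy HK]]; exists [], y; repeat split; [constructor|exact Hy|exact HK].
      * intros [u [Hu [ys [y [Hys [Hf HK]]]]]]; exists (u :: ys), y.
        rewrite <- app_assoc in Hf; repeat split; [now constructor|exact Hf|exact HK].
    + easy.
    + destruct v as [|v]; simpl.
      * intros HK; exists n; split; [|exact HK]; intros Hlt H0; now constructor.
      * intros [u [Hu [y [Hy HK]]]]; exists y; split; [|exact HK].
        intros Hlt Hv; apply Hy; [|exact Hu].
        (* The nonzero value [S v] just returned settles [m = n]; smaller [m] are covered by the
           premise of the implication stored in the frame. *)
        intros m Hm; destruct (Nat.eq_dec m n) as [->|]; [|apply Hlt; lia].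
        exists (S v); split; [lia|exact Hv].
Qed.

Lemma halted_mstep st : halted st = true -> mstep A st = st.
Proof. destruct st as [[|v] [|F K]]; simpl; easy. Qed.

Lemma mrun_halted_mono st j k : j <= k ->
  halted (mrun A st j) = true -> halted (mrun A st k) = true.
Proof.
  intros Hjk Hj; induction Hjk as [|k Hjk IH]; [exact Hj|].
  unfold mrun in *; simpl; now rewrite halted_mstep.
Qed.

Lemma halted_iff_eval c l :
  (exists y, eval A c l y) <-> exists k, halted (mrun A (inl (c, l), nil) k) = true.
Proof.
  split.
  - intros [y Hy]; destruct (eval_reaches c l y Hy nil) as [k Hk]; exists k; now rewrite Hk.
  - intros [k Hk].
    assert (Hg : good (mrun A (inl (c, l), nil) k))
      by (destruct (mrun _ _ k) as [[|v] [|F K]]; easy).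
    clear Hk; induction k as [|k IH].
    + destruct Hg as [y [Hy _]]; eauto.
    + apply IH, good_mstep, Hg.
Qed.

(* The machine is only specified on numbers that code programs; elsewhere [H] is
   whatever its realizer computes. *)
Lemma universal_halting : exists H : nat -> list nat -> nat -> bool,
  cpt A (fun p => H (fst p) (fst (snd p)) (snd (snd p))) /\
  (forall c l, (exists y, eval A c l y) <-> exists k, H (enc c) l k = true) /\
  (forall c l j k, j <= k -> H (enc c) l j = true -> H (enc c) l k = true).
Proof.
  assert (HM : cpt A (fun p : code * (list nat * nat) =>
            halted (mrun A (inl (fst p, fst (snd p)), nil) (snd (snd p))))).
  { unfold mrun, halted; pose proof (cpt_mstep A) as Hs; unfold mstate, frame in *.
    cpt. }
  destruct HM as [F [HF EF]].
  set (H := fun (e : nat) (l : list nat) (k : nat) => negb (F (npair e (enc (l, k))) =? 0)).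
  assert (EH : forall c l k, H (enc c) l k = halted (mrun A (inl (c, l), nil) k)).
  { intros c l k; unfold H; change (npair (enc c) (enc (l, k))) with (enc (c, (l, k))).
    rewrite EF; simpl; now destruct (halted _). }
  exists H; repeat split.
  - assert (HF' : cpt A F) by (exists F; split; [exact HF|reflexivity]).
    assert (Hn : cpt A (fun p : nat * (list nat * nat) => npair (fst p) (enc (snd p)))).
    { destruct (cpt_id A (T := nat * (list nat * nat))) as [G HG]; now exists G. }
    unfold H; eapply cpt_negb, cpt_eqb; [|cpt].
    refine (cpt_ext A _ _ _ (cpt_comp A _ _ HF' Hn)).
    intros [e [l k]]; reflexivity.
  - intros Hy; apply halted_iff_eval in Hy; destruct Hy as [k Hk]; exists k; now rewrite EH.
  - intros [k Hk]; rewrite EH in Hk; apply halted_iff_eval; eauto.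
  - intros c l j k Hjk; rewrite !EH; now apply mrun_halted_mono.
Qed.

End Machine.

(** * Measure on strings *)

Lemma length_tab {U} (f : nat -> U) n : length (tab f n) = n.
Proof. unfold tab; now rewrite length_map, length_seq. Qed.

Lemma nth_tab {U} (f : nat -> U) n k d : k < n -> nth k (tab f n) d = f k.
Proof.
  intros Hk; unfold tab; rewrite (nth_indep _ d (f 0)) by now rewrite length_map, length_seq.
  now rewrite map_nth, seq_nth.
Qed.

Lemma tab_ext {U} (f g : nat -> U) n : (forall k, k < n -> f k = g k) -> tab f n = tab g n.
Proof. intros E; apply map_ext_in; intros k Hk; apply in_seq in Hk; apply E; lia. Qed.

Lemma tab_S {U} (f : nat -> U) n : tab f (S n) = f 0 :: tab (fun k => f (S k)) n.
Proof. unfold tab; simpl; f_equal; now rewrite <- seq_shift, map_map. Qed.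

Lemma tab_snoc {U} (f : nat -> U) n : tab f (S n) = tab f n ++ [f n].
Proof. unfold tab; now rewrite seq_0_S, map_app. Qed.

Lemma tab_nth {U} (l : list U) d : tab (fun k => nth k l d) (length l) = l.
Proof. induction l; simpl; [easy|]; rewrite tab_S; simpl; now rewrite IHl. Qed.

Lemma init_seg_tab s X : init_seg s X <-> tab X (length s) = s.
Proof.
  split.
  - intros Hs; rewrite <- (tab_nth s false) at 2; apply tab_ext; intros; symmetry; now apply Hs.
  - intros E i Hi; rewrite <- E; now apply nth_tab.
Qed.

(* Strings are padded with [false], so [cut n s] always has length [n]. *)
Definition cut (n : nat) (s : list bool) : list bool := tab (fun k => nth k s false) n.

Lemma length_cut n s : length (cut n s) = n.
Proof. apply length_tab. Qed.

Lemma cut_tab X n m : n <= m -> cut n (tab X m) = tab X n.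
Proof. intros; apply tab_ext; intros; apply nth_tab; lia. Qed.

Lemma cut_cut n m s : n <= m -> cut n (cut m s) = cut n s.
Proof. apply cut_tab. Qed.

Lemma cut_app n s t : n <= length s -> cut n (s ++ t) = cut n s.
Proof. intros Hn; apply tab_ext; intros; apply app_nth1; lia. Qed.

Lemma forallb_lt_iff n p : forallb_lt n p = true <-> forall k, k < n -> p k = true.
Proof.
  unfold forallb_lt; rewrite forallb_forall; split; intros H k Hk; apply H.
  - apply in_seq; lia.
  - apply in_seq in Hk; lia.
Qed.

Lemma existsb_lt_iff n p : existsb_lt n p = true <-> exists k, k < n /\ p k = true.
Proof.
  unfold existsb_lt; rewrite existsb_exists; split; intros [k [Hk Hp]]; exists k; split; auto.
  - apply in_seq in Hk; lia.
  - apply in_seq; lia.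
Qed.

Lemma existsb_lt_S n p : existsb_lt (S n) p = (existsb_lt n p || p n)%bool.
Proof.
  unfold existsb_lt; rewrite seq_0_S, existsb_app; simpl; now rewrite Bool.orb_false_r.
Qed.

Local Open Scope R_scope.

Lemma psum_le f g N : (forall k, (k < N)%nat -> f k <= g k) -> psum f N <= psum g N.
Proof.
  induction N as [|N IH]; intros H; simpl; [lra|].
  pose proof (H N (Nat.lt_succ_diag_r N)); assert (psum f N <= psum g N) by (apply IH; auto); lra.
Qed.

Lemma psum_swap (f : nat -> nat -> R) M N :
  psum (fun i => psum (f i) N) M = psum (fun j => psum (fun i => f i j) M) N.
Proof.
  induction M as [|M IH]; simpl.
  - induction N as [|N IH]; simpl; [easy|rewrite <- IH; lra].
  - rewrite IH; clear IH; induction N as [|N IH]; simpl; [lra|rewrite <- IH; lra].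
Qed.

Lemma psum_extend f M N : (M <= N)%nat -> (forall k, 0 <= f k) -> psum f M <= psum f N.
Proof. intros H Hf; induction H; simpl; [lra|pose proof (Hf m); lra]. Qed.

Lemma psum_geometric c N : 0 <= c -> psum (fun k => c * (/ 2) ^ k) N <= 2 * c.
Proof.
  intros Hc; assert (E : psum (fun k => c * (/ 2) ^ k) N = 2 * c * (1 - (/ 2) ^ N))
    by (induction N as [|N IH]; simpl; [lra|rewrite IH; lra]).
  rewrite E; assert (0 <= (/ 2) ^ N) by (apply pow_le; lra); nra.
Qed.

(** The uniform measure of the sequences whose first [L] bits satisfy [p]; averaging over the first
    bit turns most facts into inductions on [L]. *)
Fixpoint mu (L : nat) (p : list bool -> bool) : R :=
  match L with
  | O => if p nil then 1 else 0
  | S L => (mu L (fun s => p (false :: s)) + mu L (fun s => p (true :: s))) / 2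
  end.

Lemma mu_le L p q : (forall s, length s = L -> p s = true -> q s = true) -> mu L p <= mu L q.
Proof.
  revert p q; induction L as [|L IH]; intros p q H; simpl.
  - specialize (H nil eq_refl); destruct (p nil), (q nil); try discriminate (H eq_refl); lra.
  - assert (mu L (fun s => p (false :: s)) <= mu L (fun s => q (false :: s)))
      by (apply IH; intros; apply H; simpl; auto).
    assert (mu L (fun s => p (true :: s)) <= mu L (fun s => q (true :: s)))
      by (apply IH; intros; apply H; simpl; auto).
    lra.
Qed.

Lemma mu_const L b : mu L (fun _ => b) = if b then 1 else 0.
Proof. induction L as [|L IH]; simpl; [easy|]; rewrite IH; destruct b; lra. Qed.

Lemma mu_split L p q :
  mu L p = mu L (fun s => p s && q s)%bool + mu L (fun s => p s && negb (q s))%bool.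
Proof.
  revert p q; induction L as [|L IH]; intros p q; simpl.
  - destruct (p nil), (q nil); simpl; lra.
  - rewrite (IH (fun s => p (false :: s)) (fun s => q (false :: s))).
    rewrite (IH (fun s => p (true :: s)) (fun s => q (true :: s))); lra.
Qed.

Lemma mu_or L p q : mu L (fun s => p s || q s)%bool <= mu L p + mu L q.
Proof.
  rewrite (mu_split L _ p).
  assert (mu L (fun s => (p s || q s) && p s)%bool <= mu L p)
    by (apply mu_le; intros s _; destruct (p s), (q s); easy).
  assert (mu L (fun s => (p s || q s) && negb (p s))%bool <= mu L q)
    by (apply mu_le; intros s _; destruct (p s), (q s); easy).
  lra.
Qed.

Lemma mu_diff L p q : mu L p - mu L q <= mu L (fun s => p s && negb (q s))%bool.
Proof.
  rewrite (mu_split L p q).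
  assert (mu L (fun s => p s && q s)%bool <= mu L q)
    by (apply mu_le; intros s _; destruct (p s), (q s); easy).
  lra.
Qed.

Lemma mu_existsb_lt L N p :
  mu L (fun s => existsb_lt N (fun i => p i s)) <= psum (fun i => mu L (p i)) N.
Proof.
  induction N as [|N IH]; simpl.
  - unfold existsb_lt; simpl; rewrite mu_const; lra.
  - eapply Rle_trans; [|apply Rplus_le_compat_r, IH].
    eapply Rle_trans; [|apply mu_or].
    apply mu_le; intros s _; now rewrite existsb_lt_S.
Qed.

Lemma mu_cut L n p : (n <= L)%nat -> mu L (fun s => p (cut n s)) = mu n p.
Proof.
  revert L p; induction n as [|n IH]; intros L p HL; [exact (mu_const L (p nil))|].
  destruct L as [|L]; [lia|]; simpl; unfold cut.
  rewrite <- (IH L (fun s => p (false :: s))) by lia.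
  rewrite <- (IH L (fun s => p (true :: s))) by lia.
  do 2 f_equal; apply Rle_antisym; apply mu_le; intros s _; rewrite tab_S; easy.
Qed.

Lemma mu_pos_exists L p : 0 < mu L p -> exists s, length s = L /\ p s = true.
Proof.
  revert p; induction L as [|L IH]; intros p; simpl.
  - destruct (p nil) eqn:E; [now exists nil|lra].
  - intros H; destruct (Rlt_dec 0 (mu L (fun s => p (false :: s)))) as [H0|H0].
    + destruct (IH _ H0) as [s [Hs Hp]]; exists (false :: s); simpl; auto.
    + destruct (IH (fun s => p (true :: s))) as [s [Hs Hp]]; [lra|].
      exists (true :: s); simpl; auto.
Qed.

(** This ties the integer count that the construction can compute to the measure. *)
Lemma count_mu L p : INR (count p (strs L)) = mu L p * 2 ^ L.
Proof.
  assert (E : forall b l (q : list bool -> bool),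
             count q (map (cons b) l) = count (fun s => q (b :: s)) l).
  { unfold count; induction l as [|s l IHl]; intros q; simpl; [easy|].
    destruct (q (b :: s)); simpl; now rewrite IHl. }
  revert p; induction L as [|L IH]; intros p.
  - unfold count; simpl; destruct (p nil); simpl; lra.
  - simpl strs; unfold count; rewrite filter_app, length_app, plus_INR.
    fold (count p (map (cons false) (strs L))); fold (count p (map (cons true) (strs L))).
    rewrite !E, !IH; simpl; lra.
Qed.

Definition is_prefix (s t : list bool) : bool :=
  if list_eq_dec Bool.bool_dec (cut (length s) t) s then true else false.

Lemma mu_is_prefix L s : (length s <= L)%nat -> mu L (is_prefix s) = cyl_measure s.
Proof.
  intros HL; unfold is_prefix, cyl_measure.
  rewrite (mu_cut L (length s) (fun t => if list_eq_dec Bool.bool_dec t s then true else false))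
    by exact HL.
  clear; induction s as [|b s IH]; simpl.
  - now destruct (list_eq_dec Bool.bool_dec [] []).
  - rewrite <- IH.
    assert (E : forall c, mu (length s)
        (fun t => if list_eq_dec Bool.bool_dec (c :: t) (b :: s) then true else false)
      = if Bool.eqb c b then
          mu (length s) (fun t => if list_eq_dec Bool.bool_dec t s then true else false)
        else 0).
    { intros c; destruct (Bool.eqb_spec c b) as [->|Hc].
      - apply Rle_antisym; apply mu_le; intros t _;
          destruct (list_eq_dec Bool.bool_dec (b :: t) (b :: s)), (list_eq_dec Bool.bool_dec t s);
          congruence.
      - rewrite <- (mu_const (length s) false); apply Rle_antisym; apply mu_le; intros t _;
          destruct (list_eq_dec Bool.bool_dec (c :: t) (b :: s)); congruence. }
    rewrite !E; destruct b; simpl; lra.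
Qed.

(** Compactness without regard to computability, for the measure argument only. The path follows
    nodes that have arbitrarily long extensions in [T]. *)
Lemma weak_konig (T : list bool -> Prop) :
  (forall s t, T (s ++ t) -> T s) -> (forall L, exists s, length s = L /\ T s) ->
  exists X, forall L, T (tab X L).
Proof.
  intros Htree Hinf.
  set (ext := fun s => forall L, exists t, (L <= length t)%nat /\ T (s ++ t)).
  assert (Hext : forall s, ext s -> ext (s ++ [false]) \/ ext (s ++ [true])).
  { intros s Hs; apply NNPP; intros Hn; apply not_or_and in Hn as [H0 H1].
    apply not_all_ex_not in H0 as [L0 H0]; apply not_all_ex_not in H1 as [L1 H1].
    destruct (Hs (S (L0 + L1))) as [[|b t] [Hlt Ht]]; simpl in Hlt; [lia|].
    replace (s ++ b :: t) with ((s ++ [b]) ++ t) in Ht by now rewrite <- app_assoc.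
    destruct b; [apply H1|apply H0]; exists t; split; auto; lia. }
  set (next := fun s => if excluded_middle_informative (ext (s ++ [false])) then false else true).
  set (path := fix path n := match n with O => nil | S n => path n ++ [next (path n)] end).
  assert (Hpath : forall n, ext (path n)).
  { induction n as [|n IH]; simpl.
    - intros L; destruct (Hinf L) as [s [Hs HT]]; exists s; split; [lia|exact HT].
    - unfold next; destruct excluded_middle_informative as [H|H]; [exact H|].
      destruct (Hext _ IH); [contradiction|assumption]. }
  exists (fun n => next (path n)); intros L.
  assert (E : tab (fun n => next (path n)) L = path L)
    by (induction L as [|L IH]; [easy|rewrite tab_snoc, IH; easy]).
  rewrite E; destruct (Hpath L 0%nat) as [t [_ Ht]]; eapply Htree, Ht.
Qed.

Lemma nondecreasing_almost_sup (u : nat -> R) eps :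
  (forall n m, (n <= m)%nat -> u n <= u m) -> (forall n, u n <= 1) -> 0 < eps ->
  exists n, forall m, u m <= u n + eps.
Proof.
  intros Hmon Hub Heps.
  assert (Hg : Un_growing u) by (intros n; apply Hmon; lia).
  destruct (growing_cv u Hg) as [l Hl].
  { exists 1; intros x [n ->]; apply Hub. }
  destruct (Hl eps Heps) as [n Hn]; exists n; intros m.
  pose proof (growing_ineq u l Hg Hl m); specialize (Hn n (le_n n)).
  apply Rabs_def2 in Hn; lra.
Qed.

(* Continuity from above: choosing [sm m] so late that [D m] gains almost nothing
   after level [sm m], the closed set of [X] with [D m (X | sm m)] for all [m] is a
   large subset of the intersection, and compactness keeps a small cover from
   exhausting it. *)
Lemma null_intersection_measure (D : nat -> list bool -> bool) :
  (forall n m s, (n <= m)%nat -> D m s = true -> D n s = true) ->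
  (forall n k s, (k <= length s)%nat -> D n (cut k s) = true -> D n s = true) ->
  null_class (fun X => forall n, exists k, D n (tab X k) = true) ->
  forall eps, 0 < eps -> exists n, forall L, mu L (D n) <= eps.
Proof.
  intros Hanti Hmono Hnull eps Heps; apply NNPP; intros Hno.
  assert (Hbig : forall n, exists L, eps < mu L (D n)).
  { intros n; apply NNPP; intros H; apply Hno; exists n; intros L; apply Rnot_lt_le.
    intros HL; apply H; eauto. }
  assert (Hgrow : forall n k L, (k <= L)%nat -> mu k (D n) <= mu L (D n)).
  { intros n k L HkL; rewrite <- (mu_cut L k) by exact HkL.
    apply mu_le; intros s <-; now apply Hmono. }
  assert (Hsup : forall m, exists k, forall L, mu L (D m) <= mu k (D m) + eps / 4 * (/ 2) ^ m).
  { intros m; apply (nondecreasing_almost_sup (fun k => mu k (D m))).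
    - apply Hgrow.
    - intros k; rewrite <- (mu_const k true); apply mu_le; auto.
    - apply Rmult_lt_0_compat; [lra|apply pow_lt; lra]. }
  set (sm := fun m => proj1_sig (constructive_indefinite_description _ (Hsup m))).
  assert (Hsm : forall m L, mu L (D m) <= mu (sm m) (D m) + eps / 4 * (/ 2) ^ m)
    by (intros m; unfold sm; now destruct constructive_indefinite_description).
  clearbody sm.
  destruct (Hnull (eps / 4)) as [f [Hcov Hf]]; [lra|].
  (* Each condition binds [s] only once [s] is long enough to decide it, so [T] is closed under
     prefixes and a path obeys all conditions. *)
  set (T := fun s => (forall m, (m < length s)%nat -> (sm m <= length s)%nat ->
                        D m (cut (sm m) s) = true) /\
                     (forall i, (i < length s)%nat -> (length (f i) <= length s)%nat ->
                        is_prefix (f i) s = false)).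
  destruct (weak_konig T) as [X HX].
  - intros s t [H1 H2].
    rewrite length_app in H1, H2; split.
    + intros m Hm Hsmm; rewrite <- (cut_app _ s t) by exact Hsmm; apply H1; lia.
    + intros i Hi Hfi; specialize (H2 i ltac:(lia) ltac:(lia)).
      unfold is_prefix in *; now rewrite cut_app in H2.
  - intros L; destruct (Hbig L) as [K0 HK0].
    set (K := Nat.max K0 L).
    assert (HK : eps < mu K (D L)) by (eapply Rlt_le_trans; [exact HK0|apply Hgrow; lia]).
    assert (HLK : (L <= K)%nat) by lia; clearbody K.
    (* [b1] collects strings that enter some [D m] only after level [sm m], at most [eps / 2] in
       all; [b2] collects those in the cover, at most [eps / 4]. As [D L] exceeds [eps], one of its
       strings survives both removals. *)
    set (b1 := fun m s => ((sm m <=? L)%nat && (D m s && negb (D m (cut (sm m) s))))%bool).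
    set (b2 := fun i s => ((length (f i) <=? L)%nat && is_prefix (f i) s)%bool).
    assert (Hb1 : mu K (fun s => existsb_lt L (fun m => b1 m s)) <= eps / 2).
    { eapply Rle_trans; [apply mu_existsb_lt|].
      replace (eps / 2) with (2 * (eps / 4)) by lra.
      eapply Rle_trans; [|apply psum_geometric with (N := L); lra].
      apply psum_le; intros m _; unfold b1.
      destruct (Nat.leb_spec (sm m) L) as [Hl|Hl]; cbn [andb].
      - pose proof (mu_split K (D m) (fun s => D m (cut (sm m) s))) as E.
        assert (mu (sm m) (D m) <= mu K (fun s => D m s && D m (cut (sm m) s))%bool).
        { rewrite <- (mu_cut K (sm m)) by lia; apply mu_le; intros s Hs Hd.
          rewrite Hd, Bool.andb_true_r; apply (Hmono m (sm m)); [lia|exact Hd]. }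
        specialize (Hsm m K); lra.
      - rewrite mu_const; apply Rmult_le_pos; [lra|apply pow_le; lra]. }
    assert (Hb2 : mu K (fun s => existsb_lt L (fun i => b2 i s)) <= eps / 4).
    { eapply Rle_trans; [apply mu_existsb_lt|].
      eapply Rle_trans; [|apply (Hf L)].
      apply psum_le; intros i _; unfold b2.
      destruct (Nat.leb_spec (length (f i)) L) as [Hl|Hl]; cbn [andb].
      - rewrite mu_is_prefix by lia; lra.
      - rewrite mu_const; apply pow_le; lra. }
    pose proof (mu_diff K (D L) (fun s => existsb_lt L (fun m => b1 m s))) as Hd1.
    pose proof (mu_diff K (fun s => D L s && negb (existsb_lt L (fun m => b1 m s)))%bool
                  (fun s => existsb_lt L (fun i => b2 i s))) as Hd2.
    destruct (mu_pos_exists K (fun s => (D L s && negb (existsb_lt L (fun m => b1 m s))) &&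
                negb (existsb_lt L (fun i => b2 i s)))%bool) as [s [Hs Hgood]]; [lra|].
    apply andb_prop in Hgood as [Hgood Hn2]; apply andb_prop in Hgood as [HD Hn1].
    apply Bool.negb_true_iff in Hn1, Hn2.
    exists (cut L s); split; [apply length_cut|split].
    + rewrite length_cut; intros m Hm Hsmm; rewrite cut_cut by exact Hsmm.
      destruct (D m (cut (sm m) s)) eqn:E; [reflexivity|exfalso].
      assert (existsb_lt L (fun m => b1 m s) = true); [|congruence].
      apply existsb_lt_iff; exists m; split; [exact Hm|].
      unfold b1; rewrite E, (Hanti m L s) by (lia || exact HD).
      now rewrite (proj2 (Nat.leb_le _ _) Hsmm).
    + rewrite length_cut; intros i Hi Hfi.
      destruct (is_prefix (f i) (cut L s)) eqn:E; [exfalso|reflexivity].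
      assert (existsb_lt L (fun i => b2 i s) = true); [|congruence].
      apply existsb_lt_iff; exists i; split; [exact Hi|].
      unfold b2; unfold is_prefix in *; rewrite cut_cut in E by exact Hfi.
      now rewrite E, (proj2 (Nat.leb_le _ _) Hfi).
  - destruct (Hcov X) as [i Hi].
    + intros n; exists (sm n).
      destruct (HX (S n + sm n)%nat) as [H1 _]; rewrite length_tab in H1.
      specialize (H1 n ltac:(lia) ltac:(lia)); rewrite cut_tab in H1 by lia; exact H1.
    + destruct (HX (S i + length (f i))%nat) as [_ H2]; rewrite length_tab in H2.
      specialize (H2 i ltac:(lia) ltac:(lia)); unfold is_prefix in H2.
      rewrite cut_tab in H2 by lia; apply init_seg_tab in Hi.
      destruct (list_eq_dec Bool.bool_dec (tab X (length (f i))) (f i)); congruence.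
Qed.

(** * The construction *)

Local Open Scope bool_scope.
Local Open Scope nat_scope.

Section Construction.
Variables (A : cset) (H : nat -> list nat -> nat -> bool).
Hypothesis cpt_H : cpt A (fun p => H (fst p) (fst (snd p)) (snd (snd p))).

(* Level [length s] of the intersection of the first [x + 1] open sets of the
   [e]-th Pi^0_2 class. *)
Definition in_open (e x : nat) (s : list bool) : bool :=
  forallb_lt (S x) (fun m =>
    existsb_lt (S (length s)) (fun j => H e [m; str_code (cut j s)] (length s))).

(** The bound 2^-b on the measure at level [s], cleared of denominators to become a test on
    naturals. *)
Definition small (e x s b : nat) : bool := count (in_open e x) (strs s) * 2 ^ b <=? 2 ^ s.

(* Stage [s] examines whether requirement [st_req s] may replace everything after
   position [st_pos s] of the current approximation by [st_ext s]. *)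
Definition st_req (s : nat) : nat := nfst s.
Definition st_pos (s : nat) : nat := nfst (nsnd s).
Definition st_ext (s : nat) : list bool := str_dec (nfst (nsnd (nsnd s))).
Definition st_time (s : nat) : nat := nsnd (nsnd (nsnd s)).

Definition target (s : nat) (Y : list bool) : list bool := cut (st_pos s) Y ++ st_ext s.

(* A state is the current approximation with the list of restraints; the entry of
   a requirement is 0 unless it has acted since it was last injured. *)
Definition acts (e s : nat) (st : list bool * list nat) : bool :=
  (e <=? s) && ((nth (st_req s) (snd st) 0 =? 0) &&
  (forallb_lt (st_req s) (fun j => nth j (snd st) 0 <=? st_pos s) &&
  (H (st_req s) [str_code (target s (fst st))] (st_time s) &&
   small e (st_pos s) s (e + 2 * st_req s + 3)))).

(** Truncating the list after entry [st_req s] is the injury: missing entries read as 0. The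
    successor keeps the new entry nonzero even for an empty target. *)
Definition act (s : nat) (st : list bool * list nat) : list bool * list nat :=
  (target s (fst st),
   tab (fun j => nth j (snd st) 0) (st_req s) ++ [S (length (target s (fst st)))]).

Definition run (e s : nat) : list bool * list nat :=
  prec (nil, nil) (fun t st => if acts e t st then act t st else st) s.

(** Level and stage coincide: an action at stage [n] makes bad the sequences that their first [n]
    bits place in the open set. Indices above [n] cannot act at that stage. *)
Definition bad (s : list bool) : bool :=
  existsb_lt (S (length s)) (fun e =>
    acts e (length s) (run e (length s)) && in_open e (st_pos (length s)) s).

Definition no_bad_prefix (s : list bool) : bool :=
  forallb_lt (S (length s)) (fun j => negb (bad (cut j s))).

Lemma cpt_in_open : cpt A (fun p => in_open (fst p) (fst (snd p)) (snd (snd p))).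
Proof. unfold in_open, cut; cpt. Qed.

Lemma cpt_acts : cpt A (fun p => acts (fst p) (fst (snd p)) (snd (snd p))).
Proof.
  pose proof cpt_in_open; pose proof (cpt_str_dec A).
  unfold acts, small, target, cut, st_req, st_pos, st_ext, st_time; cpt.
Qed.

Lemma cpt_run : cpt A (fun p => run (fst p) (snd p)).
Proof.
  pose proof cpt_acts; pose proof (cpt_str_dec A).
  unfold run, act, target, cut, st_req, st_pos, st_ext; cpt.
Qed.

Lemma cpt_no_bad_prefix : cpt A no_bad_prefix.
Proof.
  pose proof cpt_acts; pose proof cpt_in_open; pose proof cpt_run.
  unfold no_bad_prefix, bad, cut, st_pos; cpt.
Qed.

(** * Total measure of the bad sequences *)

Local Open Scope R_scope.

(* Weighting requirement [i] by [4^-i], an action outweighs all the injuries it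
   inflicts on requirements of lower priority. *)
Fixpoint potential (q : list nat) : R :=
  match q with
  | nil => 0
  | n :: q => (match n with O => 0 | S _ => 1 end) + potential q / 4
  end.

Lemma potential_bounds q : 0 <= potential q <= 4 / 3.
Proof. induction q as [|[|n] q IH]; simpl; lra. Qed.

(** The new entry is worth [(/ 4) ^ i], and the erased tail was worth at most
    [4 / 3 * (/ 4) ^ (i + 1)], a third of that. *)
Lemma potential_act q i v : nth i q 0%nat = 0%nat ->
  potential q + 2 / 3 * (/ 4) ^ i <= potential (tab (fun j => nth j q 0%nat) i ++ [S v]).
Proof.
  revert q; induction i as [|i IH]; intros q Hq.
  - unfold tab; destruct q as [|n q]; simpl in *; [lra|]; subst n.
    pose proof (potential_bounds q); lra.
  - rewrite tab_S; destruct q as [|n q]; simpl.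
    + specialize (IH nil (match i with O => eq_refl | S _ => eq_refl end)); simpl in IH.
      replace (tab (fun k => 0%nat) i)
        with (tab (fun j => nth j (@nil nat) 0%nat) i) by (apply tab_ext; now intros []).
      simpl; lra.
    + specialize (IH q Hq); simpl in IH; lra.
Qed.

(** The price of stage [s] for index [e]: the bound that the smallness test puts on the measure
    declared bad. *)
Definition gain (e s : nat) : R :=
  if acts e s (run e s) then (/ 2) ^ (e + 2 * st_req s + 3) else 0.

Lemma gain_ge_0 e s : 0 <= gain e s.
Proof. unfold gain; destruct acts; [apply pow_le|]; lra. Qed.

(** An action of requirement [i] costs [(/ 2) ^ (e + 3) * (/ 4) ^ i] and raises the potential by at
    least [2 / 3 * (/ 4) ^ i], whence the factor [3 / 2]. *)
Lemma gain_potential e L :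
  psum (gain e) L <= (/ 2) ^ (e + 3) * (3 / 2) * potential (snd (run e L)).
Proof.
  induction L as [|L IH]; cbn [psum]; [simpl; lra|].
  unfold gain at 2; destruct (acts e L (run e L)) eqn:E; [|unfold run in *; simpl; rewrite E; lra].
  replace (run e (S L)) with (act L (run e L)) by (unfold run in *; simpl; now rewrite E).
  unfold act; cbn [snd].
  pose proof (potential_act (snd (run e L)) (st_req L) (length (target L (fst (run e L))))) as Hp.
  replace ((/ 2) ^ (e + 2 * st_req L + 3)) with ((/ 2) ^ (e + 3) * (/ 4) ^ st_req L).
  - assert (Hc : 0 < (/ 2) ^ (e + 3)) by (apply pow_lt; lra).
    unfold acts in E; repeat rewrite Bool.andb_true_iff in E.
    specialize (Hp (proj1 (Nat.eqb_eq _ _) (proj1 (proj2 E)))).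
    apply (Rmult_le_compat_l ((/ 2) ^ (e + 3) * (3 / 2))) in Hp; [lra|].
    apply Rmult_le_pos; lra.
  - replace (e + 2 * st_req L + 3)%nat with (e + 3 + 2 * st_req L)%nat by lia.
    rewrite (pow_add _ (e + 3)), pow_mult; do 2 f_equal; simpl; field.
Qed.

Lemma mu_small e x s b : small e x s b = true <-> mu s (in_open e x) <= (/ 2) ^ b.
Proof.
  unfold small; rewrite Nat.leb_le.
  assert (Hb : 0 < 2 ^ b) by (apply pow_lt; lra); assert (Hs : 0 < 2 ^ s) by (apply pow_lt; lra).
  assert (Hb1 : 2 ^ b * (/ 2) ^ b = 1) by (rewrite <- Rpow_mult_distr, Rinv_r, pow1; lra).
  assert (E : INR (count (in_open e x) (strs s) * 2 ^ b) = mu s (in_open e x) * 2 ^ s * 2 ^ b)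
    by (rewrite mult_INR, pow_INR, count_mu; reflexivity).
  assert (E' : INR (2 ^ s) = 2 ^ s) by now rewrite pow_INR.
  split; intros Hle.
  - apply le_INR in Hle; rewrite E, E' in Hle.
    apply Rmult_le_reg_r with (2 ^ s * 2 ^ b); [now apply Rmult_lt_0_compat|].
    replace ((/ 2) ^ b * (2 ^ s * 2 ^ b)) with (2 ^ s * (2 ^ b * (/ 2) ^ b)) by ring.
    rewrite Hb1; lra.
  - apply INR_le; rewrite E, E'.
    replace (2 ^ s) with ((/ 2) ^ b * 2 ^ s * 2 ^ b) at 2
      by (replace ((/ 2) ^ b * 2 ^ s * 2 ^ b) with (2 ^ s * (2 ^ b * (/ 2) ^ b)) by ring;
          rewrite Hb1; ring).
    apply Rmult_le_compat_r; [lra|]; apply Rmult_le_compat_r; lra.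
Qed.

Lemma mu_bad s : mu s bad <= psum (fun e => gain e s) (S s).
Proof.
  eapply Rle_trans; [|apply psum_le with (f := fun e => mu s (fun t =>
      acts e s (run e s) && in_open e (st_pos s) t)%bool)].
  - eapply Rle_trans; [|apply mu_existsb_lt].
    apply mu_le; intros t Ht; unfold bad; now rewrite Ht.
  - intros e _; unfold gain; destruct (acts e s (run e s)) eqn:E; simpl.
    + unfold acts in E; repeat rewrite Bool.andb_true_iff in E; now apply mu_small.
    + rewrite mu_const; lra.
Qed.

(** After exchanging the sums over stages and indices, index [e] costs at most
    [(/ 2) ^ (e + 3) * (3 / 2) * (4 / 3)], a quarter of [(/ 2) ^ e], so measure at least 1/2 is left
    at every level. *)
Lemma no_bad_prefix_exists L : exists s, length s = L /\ no_bad_prefix s = true.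
Proof.
  assert (Hle : mu L (fun s => existsb_lt (S L) (fun j => bad (cut j s))) <= 1 / 2).
  { eapply Rle_trans; [apply mu_existsb_lt|].
    eapply Rle_trans;
      [apply psum_le with (g := fun j => psum (fun e => gain e j) (S L))|].
    - intros j Hj; rewrite mu_cut by lia; eapply Rle_trans; [apply mu_bad|].
      apply psum_extend; [lia|intros; apply gain_ge_0].
    - rewrite psum_swap; replace (1 / 2) with (2 * (/ 4)) by lra.
      eapply Rle_trans; [|apply psum_geometric with (N := S L); lra].
      apply psum_le; intros e _.
      eapply Rle_trans; [apply gain_potential|].
      destruct (potential_bounds (snd (run e (S L)))) as [_ Hp].
      assert (Hc : 0 < (/ 2) ^ e) by (apply pow_lt; lra).
      rewrite pow_add; simpl ((/ 2) ^ 3).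
      apply (Rmult_le_compat_l ((/ 2) ^ e * (3 / 16))) in Hp; lra. }
  destruct (mu_pos_exists L
    (fun s => true && negb (existsb_lt (S L) (fun j => bad (cut j s))))%bool)
    as [s [Hs Hg]].
  - eapply Rlt_le_trans; [|apply mu_diff]; rewrite mu_const; lra.
  - exists s; split; [exact Hs|]; apply Bool.negb_true_iff in Hg.
    apply forallb_lt_iff; intros j Hj; apply Bool.negb_true_iff.
    destruct (bad (cut j s)) eqn:E; [|reflexivity].
    rewrite <- Hg; symmetry; apply existsb_lt_iff; exists j; split; [lia|exact E].
Qed.

(** * Finite injury *)

Local Open Scope nat_scope.

Lemma in_open_antitone e n m s : n <= m -> in_open e m s = true -> in_open e n s = true.
Proof.
  unfold in_open; rewrite !forallb_lt_iff; intros Hnm Hm k Hk; apply Hm; lia.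
Qed.

Lemma acts_iff e s st : acts e s st = true <->
  e <= s /\ nth (st_req s) (snd st) 0 = 0 /\
  (forall j, j < st_req s -> nth j (snd st) 0 <= st_pos s) /\
  H (st_req s) [str_code (target s (fst st))] (st_time s) = true /\
  small e (st_pos s) s (e + 2 * st_req s + 3) = true.
Proof.
  unfold acts; rewrite !Bool.andb_true_iff, Nat.leb_le, Nat.eqb_eq, forallb_lt_iff.
  setoid_rewrite Nat.leb_le; tauto.
Qed.

Lemma run_S e s : run e (S s) = if acts e s (run e s) then act s (run e s) else run e s.
Proof. reflexivity. Qed.

Lemma nth_target s Y y : y < st_pos s -> nth y (target s Y) false = nth y Y false.
Proof.
  intros Hy; unfold target; rewrite app_nth1 by now rewrite length_cut.
  unfold cut; now rewrite nth_tab.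
Qed.

Lemma nth_restraint_act_lt s st i : i < st_req s -> nth i (snd (act s st)) 0 = nth i (snd st) 0.
Proof.
  intros Hi; unfold act; simpl; rewrite app_nth1 by now rewrite length_tab.
  now rewrite nth_tab.
Qed.

Lemma nth_restraint_act_eq s st :
  nth (st_req s) (snd (act s st)) 0 = S (length (target s (fst st))).
Proof.
  unfold act; simpl; rewrite app_nth2; rewrite length_tab; [now rewrite Nat.sub_diag|lia].
Qed.

Lemma nth_restraint_act_gt s st i : st_req s < i -> nth i (snd (act s st)) 0 = 0.
Proof.
  intros Hi; unfold act; simpl; apply nth_overflow.
  rewrite length_app, length_tab; simpl; lia.
Qed.

(** An entry survives only actions of requirements of larger index, and these must start beyond it,
    so the string that created it stays in the approximation. *)
Lemma restraint_met e t i l : nth i (snd (run e t)) 0 = S l ->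
  exists s, length s = l /\ (exists k, H i [str_code s] k = true) /\
    forall y, y < l -> nth y (fst (run e t)) false = nth y s false.
Proof.
  revert l; induction t as [|t IH]; intros l.
  - unfold run; simpl; destruct i; discriminate.
  - rewrite run_S; destruct (acts e t (run e t)) eqn:E; [|apply IH].
    apply acts_iff in E as [_ [_ [Hr [HW _]]]].
    destruct (lt_eq_lt_dec i (st_req t)) as [[Hi| ->]|Hi].
    + rewrite nth_restraint_act_lt by exact Hi; intros Hl.
      destruct (IH l Hl) as [s [Hs [Hk Hy]]]; exists s; repeat split; auto.
      intros y Hyl; rewrite <- Hy by exact Hyl; apply nth_target.
      specialize (Hr i Hi); lia.
    + rewrite nth_restraint_act_eq; intros Hl; injection Hl as <-.
      exists (target t (fst (run e t))); repeat split; eauto.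
    + rewrite nth_restraint_act_gt by exact Hi; discriminate.
Qed.

Lemma restraint_stable e t0 i :
  (forall t, t0 <= t -> acts e t (run e t) = true -> i <= st_req t) ->
  forall t j, t0 <= t -> j < i -> nth j (snd (run e t)) 0 = nth j (snd (run e t0)) 0.
Proof.
  intros Hno t j Ht Hj; induction Ht as [|t Ht IH]; [reflexivity|].
  rewrite run_S, <- IH; destruct (acts e t (run e t)) eqn:E; [|reflexivity].
  apply nth_restraint_act_lt; specialize (Hno t Ht E); lia.
Qed.

(** Once smaller indices are silent, an action of [i] makes its entry nonzero for good, and a
    nonzero entry forbids [i] to act again. *)
Lemma finite_injury e i : exists t0, forall t,
  t0 <= t -> acts e t (run e t) = true -> i <= st_req t.
Proof.
  induction i as [|i [t0 IH]]; [exists 0; intros; lia|].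
  destruct (classic (exists t, t0 <= t /\ acts e t (run e t) = true /\ st_req t = i))
    as [[t1 [Ht1 [Ha Hi]]]|Hno].
  - exists (S t1).
    assert (Hgt : forall t, S t1 <= t -> nth i (snd (run e t)) 0 <> 0 ->
              acts e t (run e t) = true -> S i <= st_req t).
    { intros t Ht Hn Hat; pose proof (IH t ltac:(lia) Hat).
      apply acts_iff in Hat as [_ [Hz _]].
      destruct (Nat.eq_dec (st_req t) i) as [Hq|]; [rewrite Hq in Hz; easy|lia]. }
    assert (Hnz : forall t, S t1 <= t -> nth i (snd (run e t)) 0 <> 0).
    { intros t Ht; induction Ht as [|t Ht IHt].
      - rewrite run_S, Ha, <- Hi, nth_restraint_act_eq; discriminate.
      - rewrite run_S; destruct (acts e t (run e t)) eqn:E; [|exact IHt].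
        rewrite nth_restraint_act_lt; [exact IHt|apply Hgt; assumption]. }
    auto.
  - exists t0; intros t Ht Hat; pose proof (IH t Ht Hat).
    destruct (Nat.eq_dec (st_req t) i); [|lia]; exfalso; eauto.
Qed.

(** * The limit of one construction *)

Section Limit.
Variables (e : nat) (X : cset) (h : nat -> nat).
Hypothesis H_mono : forall l j k, j <= k -> H e l j = true -> H e l k = true.
Hypothesis X_not_bad : forall s, bad (tab X s) = false.
Hypothesis h_open : forall y, in_open e y (tab X (h y)) = true.
Hypothesis open_small : forall b, exists x, forall s, small e x s b = true.

Lemma in_open_mono n k s : k <= length s -> in_open e n (cut k s) = true -> in_open e n s = true.
Proof.
  unfold in_open; rewrite !forallb_lt_iff, length_cut; intros Hk Hall m Hm.
  specialize (Hall m Hm); apply existsb_lt_iff in Hall as [j [Hj HH]].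
  apply existsb_lt_iff; exists j; split; [lia|].
  rewrite cut_cut in HH by lia; apply (H_mono _ k); auto.
Qed.

Lemma in_open_tab (Y : cset) :
  (forall n, exists k, in_open e n (tab Y k) = true) <->
  (forall n, exists j k, H e [n; str_code (tab Y j)] k = true).
Proof.
  split; intros HY n.
  - destruct (HY n) as [k Hk]; unfold in_open in Hk.
    rewrite forallb_lt_iff, length_tab in Hk.
    specialize (Hk n (le_n _)); apply existsb_lt_iff in Hk as [j [Hj Hk]].
    rewrite cut_tab in Hk by lia; eauto.
  (* One level must witness all [m <= n] at once, so finitely many witnesses are raised to a common
     bound. *)
  - assert (HN : forall N, exists K, forall m, m < N -> exists j, j <= K /\
              H e [m; str_code (tab Y j)] K = true).
    { induction N as [|N [K IH]]; [exists 0; intros; lia|].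
      destruct (HY N) as [j [k Hk]]; exists (K + j + k); intros m Hm.
      destruct (Nat.eq_dec m N) as [->|].
      - exists j; split; [lia|]; apply (H_mono _ k); [lia|exact Hk].
      - destruct (IH m ltac:(lia)) as [j' [Hj' Hk']]; exists j'; split; [lia|].
        apply (H_mono _ K); [lia|exact Hk']. }
    destruct (HN (S n)) as [K HK]; exists K; apply forallb_lt_iff; intros m Hm.
    destruct (HK m Hm) as [j [Hj Hk]]; rewrite length_tab.
    apply existsb_lt_iff; exists j; split; [lia|]; now rewrite cut_tab.
Qed.

(** Reading bit [y] at stage [h y], where it is already final, makes it computable from [run] and
    [h]. *)
Definition limit (y : nat) : bool := nth y (fst (run e (h y))) false.

(* An action at or before position [y] after stage [h y] would have put [X] into
   the set of bad sequences. *)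
Lemma acts_after_h y t : h y <= t -> acts e t (run e t) = true -> y < st_pos t.
Proof.
  intros Ht Ha; destruct (le_lt_dec (st_pos t) y) as [Hle|]; [exfalso|assumption].
  specialize (X_not_bad t).
  assert (Hb : bad (tab X t) = true); [|congruence].
  unfold bad; rewrite length_tab; apply existsb_lt_iff; exists e.
  (* The clause [e <= t] of [acts] puts [e] in the range that [bad] inspects at level [t]. *)
  pose proof Ha as Ha'; apply acts_iff in Ha' as [Het _].
  split; [lia|]; rewrite Ha; simpl.
  apply in_open_antitone with y; [exact Hle|].
  apply in_open_mono with (h y); [now rewrite length_tab|].
  rewrite cut_tab by exact Ht; apply h_open.
Qed.

Lemma run_limit y t : h y <= t -> nth y (fst (run e t)) false = limit y.
Proof.
  intros Ht; induction Ht as [|t Ht IH]; [reflexivity|].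
  rewrite run_S; destruct (acts e t (run e t)) eqn:E; [|exact IH].
  rewrite <- IH; apply nth_target; now apply acts_after_h.
Qed.

Lemma run_limit_below n : exists t0, forall t y, t0 <= t -> y < n ->
  nth y (fst (run e t)) false = limit y.
Proof.
  induction n as [|n [t0 IH]]; [exists 0; intros; lia|].
  exists (t0 + h n); intros t y Ht Hy.
  destruct (Nat.eq_dec y n) as [->|]; [apply run_limit; lia|apply IH; lia].
Qed.

Lemma small_antitone x x' s b : x <= x' -> small e x s b = true -> small e x' s b = true.
Proof.
  rewrite !mu_small; intros Hx Hs; eapply Rle_trans; [|exact Hs].
  apply mu_le; intros t _; now apply in_open_antitone.
Qed.

(** Enlarging the time component makes a given candidate action come up at arbitrarily late
    stages. *)
Lemma stage_surj i x r k : exists t, k <= t /\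
  st_req t = i /\ st_pos t = x /\ st_ext t = r /\ st_time t = k.
Proof.
  exists (npair i (npair x (npair (str_code r) k))).
  unfold st_req, st_pos, st_ext, st_time; rewrite !nsnd_npair, !nfst_npair, str_dec_code.
  repeat split; repeat (eapply Nat.le_trans; [|apply npair_ge_snd]); apply le_n.
Qed.

(** After the last action of the requirements up to [i], the entry of [i] decides the case. If
    nonzero, the string behind it stays in the limit; if zero, an enumerated extension of a long
    enough initial segment would trigger one more action. *)
Lemma limit_meets_or_avoids i :
  (forall l j k, j <= k -> H i l j = true -> H i l k = true) ->
  (exists s, init_seg s limit /\ exists k, H i [str_code s] k = true) \/
  (exists s, init_seg s limit /\ forall t, prefix s t -> ~ exists k, H i [str_code t] k = true).
Proof.
  intros Hi_mono; destruct (finite_injury e i) as [t0 Hinj].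
  destruct (finite_injury e (S i)) as [t1 Hinj1].
  destruct (nth i (snd (run e (t0 + t1))) 0) as [|l] eqn:El.
  - right.
    destruct (open_small (e + 2 * i + 3)) as [x0 Hx0].
    (* A position open to [i] at all late stages: the open set stays small there, and the restraints
       of smaller indices, final since [t0], lie below it. *)
    assert (Hmax : exists x, x0 <= x /\ forall j, j < i -> nth j (snd (run e t0)) 0 <= x).
    { clear; induction i as [|i [x [Hx IH]]]; [exists x0; split; [lia|intros; lia]|].
      exists (x + nth i (snd (run e t0)) 0); split; [lia|]; intros j Hj.
      destruct (Nat.eq_dec j i) as [->|]; [lia|specialize (IH j ltac:(lia)); lia]. }
    destruct Hmax as [x [Hx Hxr]].
    exists (tab limit x); split; [apply init_seg_tab; now rewrite length_tab|].
    intros s [r ->] [k Hk].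
    destruct (run_limit_below x) as [t2 Ht2].
    (* Late enough for the enumeration ([k]), for index [e] to be active, for the restraints to have
       settled ([t0], [t1]) and for the approximation to agree with [limit] below [x] ([t2]). *)
    destruct (stage_surj i x r (k + e + t0 + t1 + t2)) as [t [Ht [Hr [Hp [Hext Htime]]]]].
    assert (Hstat : nth i (snd (run e t)) 0 = 0).
    { refine (eq_trans _ El); apply (restraint_stable e (t0 + t1) (S i)); [|lia|lia].
      intros u Hu; apply Hinj1; lia. }
    assert (Hact : acts e t (run e t) = true).
    { apply acts_iff; rewrite Hr, Hp, Htime; repeat split; [lia|exact Hstat| | |].
      - intros j Hj; rewrite (restraint_stable e t0 i Hinj) by lia; now apply Hxr.
      - apply (Hi_mono _ k); [lia|]; rewrite <- Hk; do 3 f_equal.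
        unfold target; rewrite Hp, Hext; f_equal; apply tab_ext; intros y Hy; apply Ht2; lia.
      - apply small_antitone with x0; auto. }
    specialize (Hinj1 t ltac:(lia) Hact); lia.
  - left; destruct (restraint_met e _ _ _ El) as [s [Hs [Hk Hy]]].
    exists s; split; [|exact Hk]; intros y Hyl; rewrite <- Hy by lia.
    destruct (run_limit_below l) as [t2 Ht2].
    rewrite <- (Ht2 (t0 + t1 + t2)) by lia.
    (* Requirements up to [i] are silent, and the others must start beyond the restraint [S l]. *)
    assert (Hconst : forall t, t0 + t1 <= t ->
              nth y (fst (run e t)) false = nth y (fst (run e (t0 + t1))) false).
    { intros t Ht; induction Ht as [|t Ht IH]; [reflexivity|].
      rewrite run_S, <- IH; destruct (acts e t (run e t)) eqn:E; [|reflexivity].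
      apply nth_target; pose proof (Hinj1 t ltac:(lia) E) as Hreq.
      apply acts_iff in E as [_ [_ [Hrest _]]]; specialize (Hrest i Hreq).
      rewrite (restraint_stable e (t0 + t1) (S i)), El in Hrest; [lia| |lia|lia].
      intros u Hu; apply Hinj1; lia. }
    symmetry; apply Hconst; lia.
Qed.

End Limit.
End Construction.

(** * Assembly inside the Scott set *)

Lemma cpt_turing_le (Z Y : cset) : cpt Z (Y : nat -> bool) -> turing_le Y Z.
Proof.
  intros [F [[c Hc] EF]]; exists c; intros n.
  specialize (EF n); unfold enc, Enc_nat, Enc_bool in EF; rewrite <- EF; apply Hc.
Qed.

Lemma join_l X Y n : join X Y (2 * n) = X n.
Proof. unfold join; now rewrite Nat.even_even, Nat.div2_double. Qed.

Lemma join_r X Y n : join X Y (S (2 * n)) = Y n.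
Proof.
  unfold join; rewrite Nat.div2_succ_double.
  replace (S (2 * n)) with (2 * n + 1) by lia; now rewrite Nat.even_odd.
Qed.

Lemma cpt_join_l X Y : cpt (join X Y) (X : nat -> bool).
Proof.
  pose proof (cpt_oracle (join X Y)).
  apply cpt_ext with (fun n => join X Y (2 * n)); [apply join_l|cpt].
Qed.

Lemma cpt_join_r X Y : cpt (join X Y) (Y : nat -> bool).
Proof.
  pose proof (cpt_oracle (join X Y)).
  apply cpt_ext with (fun n => join X Y (S (2 * n))); [apply join_r|cpt].
Qed.

Theorem theorem2 (S : cset -> Prop) (A : cset) :
  scott_set S -> S A ->
  (exists X, S X /\ weakly_2_random_rel A X) \/
  (exists X, S X /\ one_generic_rel A X).
Proof.
  intros [_ [Hclosed [Hjoin Hwkl]]] HA.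
  destruct (universal_halting A) as [H [HH [Huniv Hmono]]].
  destruct (Hwkl (fun s => no_bad_prefix H s = true) A HA) as [X [HX Hpath]].
  - intros s t [u ->]; unfold no_bad_prefix; rewrite !forallb_lt_iff, length_app; intros Hst j Hj.
    rewrite <- (cut_app j s u) by lia.
    apply Hst; lia.
  - intros l.
    (* A string longer than every member of [l] lies outside [l]. *)
    destruct (no_bad_prefix_exists H (Datatypes.S (list_max (map (@length bool) l))))
      as [s [Hs Hg]].
    exists s; split; [exact Hg|]; intros Hin.
    assert (Hle : length s <= list_max (map (@length bool) l)); [|lia].
    assert (Hall := proj1 (list_max_le (map (@length bool) l) _) (le_n _)).
    rewrite Forall_forall in Hall; apply Hall, in_map, Hin.
  - assert (Hc : cpt A (fun n => no_bad_prefix H (str_dec n))).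
    { pose proof (cpt_no_bad_prefix A H HH); pose proof (cpt_str_dec A); cpt. }
    destruct Hc as [F [[c Hc] EF]]; exists c; intros s.
    specialize (Hc (str_code s)); specialize (EF (str_code s)).
    change (enc (str_code s)) with (str_code s) in EF; rewrite EF, str_dec_code in Hc.
    destruct (no_bad_prefix H s); split; intros; easy.
  - destruct (classic (weakly_2_random_rel A X)) as [Hr|Hr]; [left; eauto|right].
    apply not_all_ex_not in Hr as [P HP].
    apply imply_to_and in HP as [[c Hc] HP]; apply imply_to_and in HP as [Hnull HPX].
    apply NNPP in HPX.
    (* The index is the code of a program for [P]; since [H] is universal, its construction is among
       those whose bad sequences [X] already avoids. *)
    set (e := enc c).
    assert (He : forall l j k, j <= k -> H e l j = true -> H e l k = true) by apply Hmono.
    assert (HPopen : forall Y, P Y <-> forall n, exists k, in_open H e n (tab Y k) = true).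
    { intros Y; rewrite Hc, (in_open_tab H e He); split; intros HY n.
      - destruct (HY n) as [s [Hs Hy]]; apply Huniv in Hy as [k Hk].
        exists (length s), k; apply init_seg_tab in Hs; now rewrite Hs.
      - destruct (HY n) as [j [k Hk]]; exists (tab Y j).
        split; [apply init_seg_tab; now rewrite length_tab|apply Huniv; eauto]. }
    assert (Hsmall : forall b, exists x, forall s, small H e x s b = true).
    { intros b; destruct (null_intersection_measure (in_open H e)) with (eps := ((/ 2) ^ b)%R)
        as [x Hx].
      - intros n m s; apply in_open_antitone.
      - intros n k s; now apply in_open_mono.
      - intros eps Heps; destruct (Hnull eps Heps) as [f [Hf Hsum]]; exists f; split; [|exact Hsum].
        intros Y HY; now apply Hf, HPopen.
      - apply pow_lt; lra.
      - exists x; intros s; now apply mu_small. }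
    assert (Hnotbad : forall s, bad H (tab X s) = false).
    { intros s; assert (Hs : init_seg (tab X s) X) by (apply init_seg_tab; now rewrite length_tab).
      apply Hpath in Hs; unfold no_bad_prefix in Hs; rewrite forallb_lt_iff, length_tab in Hs.
      specialize (Hs s (le_n _)); rewrite cut_tab in Hs by lia; now apply Bool.negb_true_iff. }
    set (Z := join A X).
    assert (HAZ : turing_le A Z) by apply cpt_turing_le, cpt_join_l.
    pose proof (cpt_join_r A X : cpt Z (X : nat -> bool)) as HXZ.
    pose proof (cpt_relativize A Z _ HAZ (cpt_in_open A H HH)) as HoZ.
    pose proof (cpt_relativize A Z _ HAZ (cpt_run A H HH)) as HrZ.
    (* Membership is negated because [rec1_min] looks for a zero; one exists for every [y] since [X]
       lies in [P]. *)
    assert (Hsearch : cpt Z (fun p : nat * nat => negb (in_open H e (fst p) (tab X (snd p)))))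
      by cpt.
    destruct Hsearch as [F [HF EF]].
    assert (EF0 : forall y k, F (npair y k) = 0 <-> in_open H e y (tab X k) = true).
    { intros y k; change (npair y k) with (enc (y, k)); rewrite EF; simpl.
      now destruct (in_open H e y (tab X k)). }
    destruct (rec1_min Z F HF) as [h [Hh Hh0]].
    { intros y; destruct (proj1 (HPopen X) HPX y) as [k Hk]; exists k; now apply EF0. }
    assert (Hopen : forall y, in_open H e y (tab X (h y)) = true)
      by (intros y; now apply EF0).
    exists (limit H e h); split.
    + apply (Hclosed Z); [now apply Hjoin|apply cpt_turing_le].
      assert (HhZ : cpt Z h) by (exists h; split; [exact Hh|reflexivity]).
      unfold limit; cpt.
    + intros W [c' Hc'].
      destruct (limit_meets_or_avoids H e X h He Hnotbad Hopen Hsmall (enc c'))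
        as [[s [Hs Hk]]|[s [Hs Hk]]]; [apply Hmono|left|right]; exists s; split; try exact Hs.
      * apply Hc', Huniv, Hk.
      * intros t Ht HW; apply (Hk t Ht), Huniv, Hc', HW.
Qed.
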